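(* Let $\boldsymbol{a}=(a_1,\dots,a_N)$ be a sequence of positive integers with $\gcd(\boldsymbol{a})=1$, and let $f$ be a positive integer dividing some $a_i$. Let $W_f(t;\boldsymbol{a})$ be the Sylvester wave and Float-Denum the algorithm described in the context. Then Algorithm Float-Denum correctly computes $W_f(t;\boldsymbol{a})$ using $$O\big((f\,d\log(d)+N\log^2(d))\,\varphi(f)\big)$$ operations in $\mathbb{C}$, where $d=n(f\mid\boldsymbol{a})=\#\{i:f\mid a_i\}$ and $\varphi$ is Euler's totient function.
   Context: $\mathcal{P}_f$ is the set of primitive $f$-th roots of unity in $\mathbb{C}$. The Sylvester wave is $$W_f(t;\boldsymbol{a})=-\operatorname{Res}_{s=0}\sum_{\zeta\in\mathcal{P}_f}\frac{\zeta^{-t}e^{-ts}}{\prod_{i=1}^N(1-\zeta^{a_i}e^{a_is})}.$$ It is a quasi-polynomial in $t$ of period $f$; computing it means computing polynomials $P_1,\dots,P_f$ with $W_f(t;\boldsymbol{a})=P_i(t)$ whenever $t\equiv i\pmod f$, $1\le i\le f$, written $W_f(t;\boldsymbol{a})=[P_1(t),\dots,P_f(t)]$. All computations are carried out over the field $\mathbb{C}$, and complexity is the number of operations in $\mathbb{C}$; $\eta_f\in\mathbb{C}$ denotes the (floating) value of $e^{2\pi\sqrt{-1}/f}$ (rounding is not part of the complexity model). Let $J_f=\{j:1\le j\le f,\ \gcd(j,f)=1\}$, $g(s)=\frac{s}{e^s-1}$ and $g(s,y)=\frac1{1-y(e^s-1)}$ as power series in $s$. Truncated products. Products of the form $e^{as}\prod_{b\in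 B_0}g(bs)\prod_{i=1}^r\prod_{b\in B_i}g(bs,y_i)\bmod\langle s^d\rangle$ (with $a\in\mathbb{Q}$, $B_i$ finite multisets of nonzero integers, $y_i\in\mathbb{C}$) are computed by the log-exponential method: compute the truncated logarithms $\ln g(s)$ and $\ln g(s,y_i)$, form $H(s)=as+\sum_{b\in B_0}\ln g(bs)+\sum_i\sum_{b\in B_i}\ln g(bs,y_i)\bmod\langle s^d\rangle$, then compute $e^{H(s)}\bmod\langle s^d\rangle$, using FFT-based power series arithmetic. Algorithm Float-Denum. Input $\boldsymbol{a}$ and symbolic $t$. For each divisor $f$ of an entry of $\boldsymbol{a}$, with $d=n(f\mid\boldsymbol{a})$: for each $j\in J_f$, compute $\frac1{1-\eta_f^{ja_i}}$ and $\frac{\eta_f^{ja_i}}{1-\eta_f^{ja_i}}$ for all $i$ with $f\nmid a_i$, and compute by the log-exponential method the numbers $A_k(f,j)\in\mathbb{C}$ with $$\prod_{i:f\mid a_i}g(a_is)\prod_{i:f\nmid a_i}g\Big(a_is,\frac{\eta_f^{ja_i}}{1-\eta_f^{ja_i}}\Big)\equiv\sum_{k=0}^{d-1}A_k(f,j)s^k\pmod{\langle s^d\rangle};$$ compute $\eta_f^{ji}$ for $1\le i\le f$, and for each $0\le m\le d-1$ the quasi-polynomial $$\frac{A_{d-1-m}(f,j)}{\prod_{i:f\nmid a_i}(1-\eta_f^{ja_i})}\big[\eta_f^{-j},\eta_f^{-2j},\dots,\eta_f^{-jf}\big].$$ Then output $W_f(t;\boldsymbol{a})=[P_1(t),\dots,P_f(t)]$,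 where $$P_i(t)=\frac1{\prod_{k:f\mid a_k}a_k}\sum_{m=0}^{d-1}\frac{(-1)^{d+m+1}}{m!}t^m\sum_{j\in J_f}\frac{\eta_f^{-ij}A_{d-1-m}(f,j)}{\prod_{k:f\nmid a_k}(1-\eta_f^{ja_k})}.$$
   Formalization: In the operation bound, log(d) is read as log(max(2,d)): for d = 1 the literal bound is 0, which the algorithm cannot meet since it performs some operations; for every d ≥ 2 the bound is as stated. *)

(* Defs.v *)
From HB Require Import structures.
From mathcomp Require Import all_boot all_order all_algebra.
From mathcomp Require Import complex.
From mathcomp Require Import all_classical all_reals all_analysis.
Set Implicit Arguments.
Unset Strict Implicit.
Unset Printing Implicit Defensive.
Import Order.TTheory GRing.Theory Num.Theory numFieldNormedType.Exports.

(* A program is a tree of scalar operations.  The algorithms below are          *)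
(* polymorphic in the scalar type [V], so that they can neither inspect nor     *)
(* combine scalars except through [op]: every scalar operation is a [Step].     *)
(* Loading an integer and loading the root of unity e^(2 pi i / n) are          *)
(* operations too.  Index arithmetic and list manipulation are not counted.     *)
Inductive op (V : Type) : Type :=
| Add of V & V
| Sub of V & V
| Mul of V & V
| Div of V & V
| Int of int
| Root of nat.

Inductive prog (V A : Type) : Type :=
| Ret of A
| Step of op V & (V -> prog V A).

Arguments Ret {V A}.
Arguments Step {V A}.

Fixpoint bind (V A B : Type) (p : prog V A) (h : A -> prog V B) : prog V B :=
  match p with
  | Ret x => h x
  | Step o k => Step o (fun v => bind (k v) h)
  end.

Declare Scope prog_scope.
Delimit Scope prog_scope with prog.
Notation "'let*' x ':=' p 'in' q" := (bind p (fun x => q))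
  (at level 200, x name, p at level 200, q at level 200) : prog_scope.
Local Open Scope prog_scope.

Section Programs.

Variable V : Type.

Definition vadd (x y : V) : prog V V := Step (Add x y) Ret.
Definition vsub (x y : V) : prog V V := Step (Sub x y) Ret.
Definition vmul (x y : V) : prog V V := Step (Mul x y) Ret.
Definition vdiv (x y : V) : prog V V := Step (Div x y) Ret.
Definition vint (n : int) : prog V V := Step (Int V n) Ret.
Definition vroot (n : nat) : prog V V := Step (Root V n) Ret.

Fixpoint mapM (A B : Type) (h : A -> prog V B) (s : seq A) : prog V (seq B) :=
  if s is x :: s' then
    let* y := h x in let* ys := mapM h s' in Ret (y :: ys)
  else Ret [::].

Definition map2M (h : V -> V -> prog V V) (s t : seq V) : prog V (seq V) :=
  mapM (fun xy => h xy.1 xy.2) (zip s t).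

Fixpoint foldM (A B : Type) (h : B -> A -> prog V B) (y : B) (s : seq A) :
    prog V B :=
  if s is x :: s' then let* y' := h y x in foldM h y' s' else Ret y.

Fixpoint powers_from (y x : V) (n : nat) : prog V (seq V) :=
  if n is n'.+1 then
    let* y' := vmul y x in let* s := powers_from y' x n' in Ret (y :: s)
  else Ret [::].

(* [:: 1; x; ...; x ^ (n - 1)] *)
Definition powers (x : V) (n : nat) : prog V (seq V) :=
  let* one := vint 1 in powers_from one x n.

(* [:: 1 / 0!; 1 / 1!; ...; 1 / (n - 1)!] *)
Fixpoint invfacts_from (x : V) (k n : nat) : prog V (seq V) :=
  if n is n'.+1 then
    let* c := vint k.+1 in
    let* x' := vdiv x c in
    let* s := invfacts_from x' k.+1 n' in Ret (x :: s)
  else Ret [::].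

Definition invfacts (n : nat) : prog V (seq V) :=
  let* one := vint 1 in invfacts_from one 0 n.

(* A polynomial or truncated power series in s is its list of coefficients,     *)
(* constant term first; missing coefficients are zero.                          *)
Definition resize (zero : V) (n : nat) (p : seq V) : seq V :=
  mkseq (nth zero p) n.

Definition padd (n : nat) (p q : seq V) : prog V (seq V) :=
  let* zero := vint 0 in map2M vadd (resize zero n p) (resize zero n q).

Definition psub (n : nat) (p q : seq V) : prog V (seq V) :=
  let* zero := vint 0 in map2M vsub (resize zero n p) (resize zero n q).

(* values of p (of size 2 ^ k) at the powers w ^ 0, ..., w ^ (2 ^ k - 1) of a   *)
(* primitive (2 ^ k)-th root of unity w                                         *)
Fixpoint fft (k : nat) (w : V) (p : seq V) : prog V (seq V) :=
  if k is k'.+1 then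
    let* w2 := vmul w w in
    let* ev := fft k' w2 (mkseq (fun i => nth w p i.*2) (2 ^ k')) in
    let* od := fft k' w2 (mkseq (fun i => nth w p i.*2.+1) (2 ^ k')) in
    let* tw := powers w (2 ^ k') in
    let* tod := map2M vmul tw od in
    let* lo := map2M vadd ev tod in
    let* hi := map2M vsub ev tod in
    Ret (lo ++ hi)
  else Ret p.

(* p * q mod s ^ n *)
Definition pmul (n : nat) (p q : seq V) : prog V (seq V) :=
  let k := up_log 2 (size p + size q) in
  let* zero := vint 0 in
  let* one := vint 1 in
  let* w := vroot (2 ^ k) in
  let* w' := vdiv one w in
  let* fp := fft k w (resize zero (2 ^ k) p) in
  let* fq := fft k w (resize zero (2 ^ k) q) in
  let* fr := map2M vmul fp fq in
  let* r := fft k w' fr in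
  let* c := vint (2 ^ k)%N in
  let* r' := mapM (fun x => vdiv x c) r in
  Ret (resize zero n r').

(* Newton iteration g <- g (2 - p g) for 1 / p mod s ^ (2 ^ k) *)
Fixpoint pinv_pow2 (k : nat) (p : seq V) : prog V (seq V) :=
  if k is k'.+1 then
    let* g := pinv_pow2 k' p in
    let* pg := pmul (2 ^ k) (take (2 ^ k) p) g in
    let* two := vint 2 in
    let* e := psub (2 ^ k) [:: two] pg in
    pmul (2 ^ k) g e
  else
    let* zero := vint 0 in
    let* one := vint 1 in
    let* c := vdiv one (nth zero p 0) in
    Ret [:: c].

(* 1 / p mod s ^ n *)
Definition pinv (n : nat) (p : seq V) : prog V (seq V) :=
  let* g := pinv_pow2 (up_log 2 n) p in Ret (take n g).

Definition pderiv (p : seq V) : prog V (seq V) :=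
  mapM (fun ix => let* c := vint (Posz ix.1) in vmul c ix.2)
    (zip (iota 1 (size p).-1) (behead p)).

Definition pinteg (p : seq V) : prog V (seq V) :=
  let* zero := vint 0 in
  let* q := mapM (fun ix => let* c := vint (Posz ix.1) in vdiv ix.2 c)
    (zip (iota 1 (size p)) p) in
  Ret (zero :: q).

(* ln p mod s ^ n (p has constant term 1), as the integral of p' / p *)
Definition pln (n : nat) (p : seq V) : prog V (seq V) :=
  let* dp := pderiv (take n p) in
  let* q := pinv n.-1 p in
  let* r := pmul n.-1 dp q in
  pinteg r.

(* Newton iteration g <- g (1 + h - ln g) for e ^ h mod s ^ (2 ^ k), h(0) = 0 *)
Fixpoint pexp_pow2 (k : nat) (h : seq V) : prog V (seq V) :=
  if k is k'.+1 then
    let* g := pexp_pow2 k' h in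
    let* l := pln (2 ^ k) g in
    let* e := psub (2 ^ k) h l in
    let* one := vint 1 in
    let* e' := padd (2 ^ k) [:: one] e in
    pmul (2 ^ k) g e'
  else let* one := vint 1 in Ret [:: one].

(* e ^ h mod s ^ n *)
Definition pexp (n : nat) (h : seq V) : prog V (seq V) :=
  let* g := pexp_pow2 (up_log 2 n) h in Ret (take n g).

(* g(s) = s / (e ^ s - 1), hence ln g(s) = - ln (\sum_k s ^ k / (k + 1)!) *)
Definition ln_g (n : nat) : prog V (seq V) :=
  let* x := invfacts n.+1 in
  let* l := pln n (behead x) in
  psub n [::] l.

(* g(s, y) = 1 / (1 - y (e ^ s - 1)) *)
Definition ln_gy (n : nat) (y : V) : prog V (seq V) :=
  let* x := invfacts n in
  let* zero := vint 0 in
  let* one := vint 1 in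
  let* y' := vsub zero y in
  let* t := mapM (vmul y') (behead x) in
  let* l := pln n (one :: t) in
  psub n [::] l.

Fixpoint prod_pairs (n : nat) (ps : seq (seq V)) : prog V (seq (seq V)) :=
  if ps is p :: q :: ps' then
    let* r := pmul (minn n (size p + size q).-1) p q in
    let* rs := prod_pairs n ps' in Ret (r :: rs)
  else Ret ps.

Fixpoint prod_tree (k n : nat) (ps : seq (seq V)) : prog V (seq (seq V)) :=
  if k is k'.+1 then
    let* qs := prod_pairs n ps in prod_tree k' n qs
  else Ret ps.

(* \prod_(b <- B) (1 - b s) mod s ^ n *)
Definition prod_linear (n : nat) (B : seq nat) : prog V (seq V) :=
  let* one := vint 1 in
  let* leaves := mapM (fun b : nat =>
    let* c := vint (- b%:Z)%R in Ret (take n [:: one; c])) B in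
  let* ps := prod_tree (up_log 2 (size B)) n leaves in
  Ret (head [:: one] ps).

(* \sum_(b <- B) l(b s) mod s ^ n for l(0) = 0, where the power sums of B are   *)
(* read off from ln (\prod_(b <- B) (1 - b s)) =                                *)
(* - \sum_(k > 0) (\sum_(b <- B) b ^ k) s ^ k / k.                              *)
Definition sum_scaled (n : nat) (l : seq V) (B : seq nat) : prog V (seq V) :=
  let* p := prod_linear n B in
  let* q := pln n p in
  mapM (fun kx : nat * (V * V) =>
    let* c := vint (- kx.1%:Z)%R in
    let* ps := vmul c kx.2.1 in
    vmul ps kx.2.2) (zip (iota 0 n) (zip q l)).

(* The log-exponential method for                                               *)
(* \prod_(b <- B0) g(b s) * \prod_((y, B) <- Bs) \prod_(b <- B) g(b s, y)       *)
(* mod s ^ n; Float-Denum does not use the extra factor e ^ (a s).              *)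
Definition log_exp (n : nat) (B0 : seq nat) (Bs : seq (V * seq nat)) :
    prog V (seq V) :=
  let* l0 := ln_g n in
  let* h0 := sum_scaled n l0 B0 in
  let* hs := mapM (fun yB : V * seq nat =>
    let* l := ln_gy n yB.1 in sum_scaled n l yB.2) Bs in
  let* h := foldM (padd n) h0 hs in
  pexp n h.

Section FloatDenum.

Variables (f : nat) (a : seq nat).

Let d := count (dvdn f) a.
Let a_dvd := [seq b <- a | f %| b].
Let a_ndvd := [seq b <- a | ~~ (f %| b)].

(* The contribution of one primitive root z = eta_f ^ j: row m < d lists        *)
(* A_(d-1-m)(f, j) / \prod_(i : f does not divide a_i) (1 - z ^ a_i) times      *)
(* z ^ -1, ..., z ^ -f.  The powers of z are tabulated once, using z ^ f = 1,   *)
(* and the a_i with f not dividing a_i are grouped by residue modulo f, that    *)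
(* is, by equal second arguments of g.                                          *)
Definition float_denum_root (z : V) : prog V (seq (seq V)) :=
  let* zs := powers z f in
  let* one := vint 1 in
  let* uy := mapM (fun b =>
    let w := nth z zs (b %% f) in
    let* den := vsub one w in
    let* u := vdiv one den in
    let* y := vdiv w den in
    Ret (b, (u, y))) a_ndvd in
  let Bs := [seq (let sel := [seq x <- uy | x.1 %% f == c] in
                  ((head (0, (z, z)) sel).2.2, [seq x.1 | x <- sel]))
            | c <- undup [seq b %% f | b <- a_ndvd]] in
  let* A := log_exp d a_dvd Bs in
  let* u := foldM vmul one [seq x.2.1 | x <- uy] in
  mapM (fun m =>
    let* c := vmul (nth z A (d - m.+1)) u in
    mapM (vmul c) (rev zs)) (iota 0 d).

(* The output lists, for i = 1, ..., f, the coefficients of P_i. *)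
Definition float_denum : prog V (seq (seq V)) :=
  let* zero := vint 0 in
  let* eta := vroot f in
  let* etas := powers eta f in
  let* rows := mapM (fun j => float_denum_root (nth zero etas (j %% f)))
    [seq j <- iota 1 f | coprime j f] in
  let* S := foldM (fun s t =>
      mapM (fun xy => map2M vadd xy.1 xy.2) (zip s t))
    (nseq d (nseq f zero)) rows in
  let* one := vint 1 in
  let* K := foldM (fun x (b : nat) => let* c := vint b in vmul x c) one a_dvd in
  let* x := invfacts d in
  let* P := mapM (fun mr : nat * (V * seq V) =>
    let* sg := vint ((-1) ^+ (d + mr.1).+1)%R in
    let* c := vmul sg mr.2.1 in
    let* c' := vdiv c K in
    mapM (vmul c') mr.2.2) (zip (iota 0 d) (zip x S)) in
  Ret [seq [seq nth zero r i | r <- P] | i <- iota 0 f].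

End FloatDenum.

End Programs.

Local Open Scope classical_set_scope.
Local Open Scope complex_scope.
Local Open Scope ring_scope.

Definition cexp (R : realType) (z : R[i]) : R[i] :=
  (expR (complex.Re z))%:C * (cos (complex.Im z) +i* sin (complex.Im z)).

(* eta_n = e^(2 pi i / n) *)
Definition eta (R : realType) (n : nat) : R[i] := cexp (0 +i* (pi *+ 2 / n%:R)).

Definition opval (R : realType) (o : op R[i]) : option R[i] :=
  match o with
  | Add x y => Some (x + y)
  | Sub x y => Some (x - y)
  | Mul x y => Some (x * y)
  | Div x y => if y == 0 then None else Some (x / y)
  | Int n => Some n%:~R
  | Root n => if n == 0%N then None else Some (eta R n)
  end.

(* number of operations performed and result, [None] upon a division by zero *)
Fixpoint run (R : realType) (A : Type) (p : prog R[i] A) : option (nat * A) :=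
  match p with
  | Ret x => Some (0%N, x)
  | Step o k =>
      if opval o is Some v then
        if run (k v) is Some nx then Some (nx.1.+1, nx.2) else None
      else None
  end.

(* [r] is the coefficient of 1 / s in a Laurent expansion of [F] at 0 with      *)
(* finite principal part \sum_k c_k / s ^ (k + 1).                              *)
Definition is_residue0 (K : numFieldType) (F : K -> K) (r : K) : Prop :=
  exists (c : seq K) (G : K -> K),
    [/\ \forall s \near (0 : K), derivable G s 1,
        \forall s \near (0 : K)^',
          F s = \sum_(k < size c) c`_k / s ^+ k.+1 + G s
      & r = c`_0].

(* residue at 0 of a function meromorphic at 0 *)
Definition residue0 (K : numFieldType) (F : K -> K) : K :=
  xget 0 [set r | is_residue0 F r].

Definition sylvester_wave (R : realType) (f : nat) (a : seq nat) (t : int) :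
    R[i] :=
  - residue0 (fun s : R[i]^o =>
      \sum_(z \in [set z : R[i] | f.-primitive_root z])
        z ^ (- t) * cexp (- (t%:~R * s))
        / \prod_(b <- a) (1 - z ^+ b * cexp (b%:R * s))).

(* ln d for d >= 2; at d = 1, where the bound f d ln d + N (ln d)^2 would       *)
(* vanish although some operations are needed, ln 2 is used instead.            *)
Definition log_pos (R : realType) (d : nat) : R := ln (maxn 2 d)%:R.

(* Main.v *)
Require Import Defs.
From mathcomp Require Import all_boot all_order all_algebra.
From mathcomp Require Import complex.
From mathcomp Require Import all_classical all_reals all_analysis.
From mathcomp Require Import ring lra zify.
Set Implicit Arguments.
Unset Strict Implicit.
Unset Printing Implicit Defensive.
Import Order.TTheory GRing.Theory Num.Theory numFieldNormedType.Exports.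
Local Open Scope ring_scope.

(** Let [d] be the number of [a_i] divisible by [f].  For a primitive [f]-th root
    of unity [z], the factor [1 - z ^ b e ^ (b s)] is [- b s] times the inverse of
    [g(b s)] if [f] divides [b], and otherwise [1 - z ^ b] times the inverse of
    [g(b s, y)] with [y = z ^ b / (1 - z ^ b)].  The term of the wave attached to
    [z] thus has a pole of order [d], and its residue is, up to a constant
    factor, the coefficient of [s ^ (d - 1)] in [z ^ (- t) e ^ (- t s) A(s)],
    where [A] is the product of all the [g(b s)] and [g(b s, y)], the inverse
    of [denum_series].  Expanding [e ^ (- t s)] gives the formula for [P_i(t)]
    ([expands_wave_term], [wave_residue]).

    The residue is the coefficient of [1 / s] in a Laurent expansion with a
    differentiable remainder.  It is unique because a polar part that cancels a
    continuous function vanishes ([residue0_unique]).  It exists because the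
    functions with a Taylor expansion, in the sense of [expands], are stable
    under sums, products and inverses, and contain the exponential: by the real
    mean value theorem along segments, the remainder of the exponential series
    after [m] terms is [O(s ^ m)] ([ray_le], [exp_rem_le], [expands_cexp]).

    On the side of the algorithm, [ok p B Q] bounds the cost of a program and
    describes its result.  Truncated power series are polynomials modulo
    ['X^n]; logarithms and exponentials are characterised by their differential
    equations ([is_log], [is_exp]), from which come the Newton iterations
    ([newton_inv], [newton_exp]) and the fact that the log-exponential method
    computes the inverse of [denum_series] ([is_exp_inv], [ok_log_exp]).

    For the cost, let [2 ^ j] be the least power of two that is at least [d].  A
    product, inverse, logarithm or exponential modulo [s ^ d] takes
    [O((j + 1) 2 ^ j)] operations, the Newton iterations being dominated by their
    last step, and a product of [m] linear factors modulo [s ^ d] takes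
    [O(m (j + 1) ^ 2)] operations by a product tree ([treecost],
    [ok_prod_tree]).  For each of the [totient f] primitive roots, grouping the
    [a_i] by residue modulo [f] leaves [O(f)] logarithms and product trees with
    [N] leaves altogether ([ok_float_denum_root], [ok_float_denum]). *)

(** * Power series modulo a power of the variable *)

Section TruncatedSeries.

Variable K : numFieldType.
Implicit Types (p q r g h l E L : {poly K}) (b y : K) (m n : nat).

(** Congruence of two polynomials modulo ['X^n]. *)
Definition eqX n p q := forall i, (i < n)%N -> p`_i = q`_i.

Lemma eqX_sym n p q : eqX n p q -> eqX n q p.
Proof. by move=> H i /H. Qed.

Lemma eqX_trans n q p r : eqX n p q -> eqX n q r -> eqX n p r.
Proof. by move=> H1 H2 i ltin; rewrite H1 // H2. Qed.

Lemma eqX_le m n p q : (m <= n)%N -> eqX n p q -> eqX m p q.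
Proof. by move=> lemn H i ltim; apply/H/(leq_trans ltim). Qed.

Lemma eqXD n p p' q q' : eqX n p p' -> eqX n q q' -> eqX n (p + q) (p' + q').
Proof. by move=> H1 H2 i ltin; rewrite !coefD H1 // H2. Qed.

Lemma eqXB n p p' q q' : eqX n p p' -> eqX n q q' -> eqX n (p - q) (p' - q').
Proof. by move=> H1 H2 i ltin; rewrite !coefB H1 // H2. Qed.

Lemma eqXM n p p' q q' : eqX n p p' -> eqX n q q' -> eqX n (p * q) (p' * q').
Proof.
move=> H1 H2 i ltin; rewrite !coefM; apply: eq_bigr => -[j /= ltj] _.
by rewrite H1 ?H2 //; lia.
Qed.

Lemma eqX_sub0 n p q : eqX n (p - q) 0 <-> eqX n p q.
Proof.
split=> H i /H; first by rewrite coefB coef0 => /eqP; rewrite subr_eq0 => /eqP.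
by rewrite coefB coef0 => ->; rewrite subrr.
Qed.

Lemma eqX_prod n (I : Type) (s : seq I) (F G : I -> {poly K}) :
  (forall i, eqX n (F i) (G i)) ->
  eqX n (\prod_(i <- s) F i) (\prod_(i <- s) G i).
Proof.
move=> FG; elim: s => [|i s IHs]; rewrite ?big_nil // !big_cons.
exact: eqXM.
Qed.

Lemma eqX_mul0 m n p q : eqX m p 0 -> eqX n q 0 -> eqX (m + n) (p * q) 0.
Proof.
move=> H1 H2 i ltin; rewrite coefM coef0 big1 // => -[j /= ltj] _.
have [ltjm|lemj] := ltnP j m; first by rewrite H1 // coef0 mul0r.
by rewrite H2 ?coef0 ?mulr0 //; lia.
Qed.

Lemma eqX_deriv n p q : eqX n p q -> eqX n.-1 p^`() q^`().
Proof. by move=> H i ltin; rewrite !coef_deriv H //; lia. Qed.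

Lemma eqX_deriv0 n p : p`_0 = 0 -> eqX n.-1 p^`() 0 -> eqX n p 0.
Proof.
move=> p0 H [|i] ltin; rewrite coef0 //.
have /eqP := H i ltac:(lia); rewrite coef_deriv coef0.
by rewrite mulrn_eq0 /= => /eqP.
Qed.

Lemma eqX_cancel n p q : p`_0 != 0 -> eqX n (p * q) 0 -> eqX n q 0.
Proof.
move=> p0 H i; elim/ltn_ind: i => i IH ltin.
have := H i ltin; rewrite coefM big_ord_recl /= subn0 big1 ?addr0 ?coef0.
  by move/eqP; rewrite mulf_eq0 (negPf p0) => /eqP.
by move=> [j /= ltj] _; rewrite IH ?coef0 ?mulr0 // /bump; lia.
Qed.

(** The series [L] is the logarithm of [p] modulo ['X^n], characterised by
    [L' p = p'] and by its constant term [0], so that [p] matters only up to a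
    scalar factor. *)
Definition is_log n p L := L`_0 = 0 /\ eqX n.-1 (L^`() * p) p^`().

(** The series [E] is the exponential of [h] modulo ['X^n], characterised by
    [E' = h' E] and by its constant term [1]; the constant term of [h] is
    disregarded. *)
Definition is_exp n h E := E`_0 = 1 /\ eqX n.-1 E^`() (h^`() * E).

Lemma is_log_eqX n p q L : eqX n p q -> is_log n p L -> is_log n q L.
Proof.
move=> pq [L0 HL]; split=> //; apply: eqX_trans (eqX_deriv pq).
apply: eqX_trans HL; apply: eqXM => //; apply: eqX_sym.
by apply: eqX_le pq; lia.
Qed.

Lemma is_log_eqXr n p L M :
  (0 < n)%N -> eqX n L M -> is_log n p L -> is_log n p M.
Proof.
move=> n0 LM [L0 HL]; split; first by rewrite -LM.
by apply: eqX_trans HL; apply: eqXM => //; apply/eqX_deriv/eqX_sym.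
Qed.

Lemma is_log_uniq n p L M :
  p`_0 != 0 -> is_log n p L -> is_log n p M -> eqX n L M.
Proof.
move=> p0 [L0 HL] [M0 HM]; apply/eqX_sub0/eqX_deriv0.
  by rewrite coefB L0 M0 subrr.
apply: (eqX_cancel p0); rewrite derivB mulrC mulrBl; apply/eqX_sub0.
exact: eqX_trans HL (eqX_sym HM).
Qed.

Lemma is_log1 n : is_log n 1 0.
Proof. by split; rewrite ?coef0 // deriv0 mul0r derivC. Qed.

Lemma is_logM n p q L M :
  is_log n p L -> is_log n q M -> is_log n (p * q) (L + M).
Proof.
move=> [L0 HL] [M0 HM]; split; first by rewrite coefD L0 M0 addr0.
rewrite derivD derivM.
have -> : (L^`() + M^`()) * (p * q) = L^`() * p * q + p * (M^`() * q) by ring.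
by apply: eqXD; apply: eqXM.
Qed.

Lemma is_log_prod n (I : Type) (s : seq I) (F G : I -> {poly K}) :
  (forall i, is_log n (F i) (G i)) ->
  is_log n (\prod_(i <- s) F i) (\sum_(i <- s) G i).
Proof.
move=> FG; elim: s => [|i s IHs]; rewrite ?big_nil ?big_cons.
  exact: is_log1.
exact: is_logM.
Qed.

(** The polynomial [p \Po (b *: 'X)] stands for the series [p (b s)]. *)
Lemma coef_scaleX b p i : (p \Po (b *: 'X))`_i = b ^+ i * p`_i.
Proof.
rewrite comp_polyE coef_sum.
under eq_bigr do rewrite exprZn !coefZ coefXn.
have [lti|lei] := ltnP i (size p).
  rewrite (bigD1 (Ordinal lti)) //= eqxx mulr1 mulrC big1 ?addr0 // => -[j ltj].
  by rewrite -val_eqE /= eq_sym => /negPf ->; rewrite !mulr0.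
rewrite big1 => [|[j /= ltj] _]; first by rewrite [p`_i]nth_default ?mulr0.
by rewrite gtn_eqF ?mulr0 // (leq_trans ltj).
Qed.

Lemma is_log_scaleX n b p L :
  is_log n p L -> is_log n (p \Po (b *: 'X)) (L \Po (b *: 'X)).
Proof.
move=> [L0 HL]; split; first by rewrite coef_scaleX L0 mulr0.
rewrite !deriv_comp mulrAC -rmorphM /=; apply: eqXM => // i ltin.
by rewrite !coef_scaleX HL.
Qed.

(** [ln (1 - b s) = - \sum_(k > 0) b ^ k s ^ k / k]; the term of index [0] of the
    polynomial below is zero because [0^-1 = 0]. *)
Lemma is_log_linear n b :
  is_log n (1 - b *: 'X) (\poly_(k < n) (- (b ^+ k / k%:R))).
Proof.
split=> [|i ltin]; first by rewrite coef_poly invr0 mulr0 oppr0; case: ifP.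
rewrite mulrBr mulr1 coefB -scalerAr coefZ coefMX !coef_deriv !coef_poly.
rewrite coefB coefC coefZ coefX.
have -> : (i.+1 < n)%N by lia.
have Hdiv j : - (b ^+ j.+1 / j.+1%:R) *+ j.+1 = - b ^+ j.+1.
  by rewrite mulNrn -[X in - X = _]mulr_natr divfK // pnatr_eq0.
rewrite Hdiv; case: i ltin => [|i] ltin /=.
  by rewrite mulr0 subr0 mulr1 sub0r expr1.
rewrite (_ : (i.+1 < n)%N); last by lia.
by rewrite Hdiv mulrN opprK -exprS addNr mulr0 subrr mul0rn.
Qed.

Lemma is_exp_eqX n h E F :
  (0 < n)%N -> eqX n E F -> is_exp n h E -> is_exp n h F.
Proof.
move=> n0 EF [E0 HE]; split; first by rewrite -EF.
apply: eqX_trans (eqX_sym (eqX_deriv EF)) _; apply: eqX_trans HE _.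
by apply: eqXM => //; apply: eqX_le EF; lia.
Qed.

Lemma is_exp_le m n h E : (m <= n)%N -> is_exp n h E -> is_exp m h E.
Proof. by move=> lemn [E0 HE]; split=> //; apply: eqX_le HE; lia. Qed.

(** If [h] is minus a logarithm of [p], its exponential inverts [p]. *)
Lemma is_exp_inv n h E p L :
  p`_0 = 1 -> is_log n p L -> eqX n h (- L) -> is_exp n h E ->
  eqX n (p * E) 1.
Proof.
move=> p0 [L0 HL] hL [E0 HE]; apply/eqX_sub0/eqX_deriv0.
  by rewrite coefB coef0M p0 E0 coef1 mulr1 subrr.
rewrite derivB derivC subr0 derivM.
have h' : eqX n.-1 h^`() (- L^`()) by rewrite -derivN; apply: eqX_deriv.
apply: (@eqX_trans _ (L^`() * p * E + p * (- L^`() * E))).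
  apply: eqXD; apply: eqXM => //; first exact: eqX_sym.
  by apply: eqX_trans HE _; apply: eqXM.
by have -> : L^`() * p * E + p * (- L^`() * E) = 0 by ring.
Qed.

(** A Newton step for the inverse doubles the precision, because it squares the
    error [1 - p g]. *)
Lemma newton_inv m p g :
  eqX m (p * g) 1 -> eqX (m + m) (p * (g * (2 - p * g))) 1.
Proof.
move=> H; apply/eqX_sub0.
have -> : p * (g * (2 - p * g)) - 1 = (p * g - 1) * (1 - p * g) by ring.
by apply: eqX_mul0; apply/eqX_sub0 => //; apply: eqX_sym.
Qed.

(** A Newton step for the exponential doubles the precision: with
    [D = h - ln g], the new [E = g (1 + D)] satisfies
    [E' - h' E = D (g' - h' g)] modulo ['X^(2 m - 1)], where the two factors on
    the right vanish modulo ['X^m] and ['X^(m - 1)]. *)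
Lemma newton_exp m h g l :
  (0 < m)%N -> h`_0 = 0 -> is_exp m h g -> is_log (m + m) g l ->
  is_exp (m + m) h (g * (1 + (h - l))).
Proof.
move=> m0 h0 [g0 Hg] [l0 Hl]; set D := h - l.
have D'E : eqX (m + m).-1 (g * D^`()) (h^`() * g - g^`()).
  rewrite derivB mulrBr [g * _]mulrC [g * _]mulrC.
  exact: eqXB.
have D0 : eqX m D 0.
  apply: eqX_deriv0; first by rewrite coefB h0 l0 subrr.
  apply: (@eqX_cancel _ g); first by rewrite g0 oner_neq0.
  apply: eqX_trans (eqX_le _ D'E) _; first by lia.
  by apply/eqX_sub0/eqX_sym.
split; first by rewrite coef0M coefD coef1 coefB h0 l0 subrr addr0 g0 mulr1.
rewrite derivM derivD derivC add0r.
apply: (@eqX_trans _ (g^`() * (1 + D) + (h^`() * g - g^`()))).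
  exact: eqXD.
apply/eqX_sub0.
have -> : g^`() * (1 + D) + (h^`() * g - g^`()) - h^`() * (g * (1 + D)) =
  D * (g^`() - h^`() * g) by ring.
apply: (@eqX_le _ (m + m.-1)); first by lia.
by apply: eqX_mul0 => //; apply/eqX_sub0.
Qed.

Lemma eqX_take n (s : seq K) : eqX n (Poly (take n s)) (Poly s).
Proof. by move=> i ltin; rewrite !coef_Poly nth_take. Qed.

Lemma eqX_mkseq n (F : nat -> K) p :
  (forall i, (i < n)%N -> F i = p`_i) -> eqX n (Poly (mkseq F n)) p.
Proof. by move=> H i ltin; rewrite coef_Poly nth_mkseq ?H. Qed.

End TruncatedSeries.

(** * The complex exponential and roots of unity *)

Lemma prim_root_neq0 (F : fieldType) n (z : F) : n.-primitive_root z -> z != 0.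
Proof.
move=> zn; apply/eqP => z0; have /eqP := prim_expr_order zn.
by rewrite z0 expr0n gtn_eqF ?(prim_order_gt0 zn) // eq_sym oner_eq0.
Qed.

Lemma prim_root_neq1 (F : fieldType) n (z : F) b :
  n.-primitive_root z -> ~~ (n %| b)%N -> 1 - z ^+ b != 0.
Proof. by move=> zn; rewrite (prim_order_dvd zn) subr_eq0 eq_sym. Qed.

Section Cexp.

Local Open Scope complex_scope.

Variable R : realType.
Implicit Types (z w : R[i]) (n k : nat).

Lemma cexp0 : cexp (0 : R[i]) = 1.
Proof. by rewrite /cexp /= expR0 cos0 sin0 mul1r. Qed.

Lemma cexpD z w : cexp (z + w) = cexp z * cexp w.
Proof.
case: z => a b; case: w => c d; rewrite /cexp /= expRD cosD sinD.
by apply/eqP; rewrite eq_complex /=; apply/andP; split; apply/eqP; ring.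
Qed.

Lemma cexpMn n z : cexp (n%:R * z) = cexp z ^+ n.
Proof.
elim: n => [|n IHn]; first by rewrite mul0r cexp0.
by rewrite -natr1 mulrDl mul1r cexpD IHn exprSr.
Qed.

Lemma eta_prim n : (0 < n)%N -> n.-primitive_root (eta R n).
Proof.
move=> n0; have n0R : n%:R != 0 :> R by rewrite pnatr_eq0 -lt0n.
have etaX k : eta R n ^+ k = cexp (0 +i* (k%:R * (pi *+ 2 / n%:R))).
  rewrite -cexpMn; congr cexp; rewrite -(rmorph_nat (real_complex R)).
  by apply/eqP; rewrite eq_complex /=; apply/andP; split; apply/eqP; ring.
have eta1 : eta R n ^+ n = 1.
  rewrite etaX mulrCA divff // mulr1 /cexp /= expR0 cos2pi sin2pi.
  by rewrite mul1r.
have [m mprim mn] := prim_order_exists n0 eta1.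
have m0 := prim_order_gt0 mprim.
suff mE : m = n by rewrite mE in mprim.
apply/eqP; rewrite eqn_leq dvdn_leq //= leqNgt; apply/negP => ltmn.
have := prim_expr_order mprim; rewrite etaX; set x : R := m%:R * (pi / n%:R).
have -> : m%:R * (pi *+ 2 / n%:R) = x *+ 2 by rewrite /x -mulrnAr -mulrnAl.
(* The angle of eta_n ^ m is 2 x with 0 < x < pi, and cos (2 x) = 1 would force
   sin x = 0. *)
have : 0 < sin x.
  apply: sin_gt0_pi; rewrite /x mulrCA pmulr_rgt0 ?pi_gt0 //.
  rewrite divr_gt0 ?ltr0n //= gtr_pMr ?pi_gt0 //.
  by rewrite ltr_pdivrMr ?ltr0n // mul1r ltr_nat.
move=> sx /(congr1 (@complex.Re R)); rewrite /cexp /= expR0 mul1r mul0r subr0.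
rewrite cos_mulr2n => cx; have := cos2Dsin2 x; have := sqr_ge0 (cos x).
have : 0 < sin x ^+ 2 by rewrite exprn_gt0.
by move: cx; rewrite mulr2n; lra.
Qed.

End Cexp.

(** * Cost and result of programs *)

Section Ok.

Variable R : realType.
Local Notation C := (complex R).

(** The program [p] divides by no zero, performs at most [B] operations, and
    its result satisfies [Q]. *)
Definition ok (A : Type) (p : prog C A) (B : nat) (Q : A -> Prop) : Prop :=
  exists c x, [/\ run p = Some (c, x), (c <= B)%N & Q x].

Lemma ok_le (A : Type) (p : prog C A) B B' (Q Q' : A -> Prop) :
  ok p B' Q' -> (B' <= B)%N -> (forall x, Q' x -> Q x) -> ok p B Q.
Proof.
move=> [c [x [px cB Qx]]] BB' QQ'; exists c, x; split=> //; last exact: QQ'.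
exact: leq_trans BB'.
Qed.

Lemma ok_cost (A : Type) (p : prog C A) B B' (Q : A -> Prop) :
  ok p B' Q -> (B' <= B)%N -> ok p B Q.
Proof. by move=> pB BB'; apply: ok_le pB _ _. Qed.

Lemma ok_ret (A : Type) (x : A) (Q : A -> Prop) : Q x -> ok (Ret x) 0 Q.
Proof. by exists 0%N, x. Qed.

Lemma ok_step (A : Type) (o : op C) v (k : C -> prog C A) B Q :
  opval o = Some v -> ok (k v) B Q -> ok (Step o k) (1 + B) Q.
Proof.
move=> ov [c [x [kx cB Qx]]]; exists c.+1, x; split=> //.
by rewrite /= ov kx.
Qed.

Lemma run_bind (A B : Type) (p : prog C A) (h : A -> prog C B) c x c' y :
  run p = Some (c, x) -> run (h x) = Some (c', y) ->
  run (bind p h) = Some ((c + c')%N, y).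
Proof.
elim: p c x => [x0|o k IHk] c x /=; first by move=> [<- <-] ->.
case: (opval o) => // v; case: (run (k v)) (IHk v) => // -[c1 x1] IH [<- <-] hx.
by rewrite (IH _ _ erefl hx).
Qed.

Lemma ok_bind (A B : Type) (p : prog C A) (h : A -> prog C B) b1 b2 Q1 Q2 :
  ok p b1 Q1 -> (forall x, Q1 x -> ok (h x) b2 Q2) ->
  ok (bind p h) (b1 + b2) Q2.
Proof.
move=> [c [x [px cB Qx]]] /(_ x Qx) [c' [y [hy c'B Qy]]].
exists (c + c')%N, y; split=> //; first exact: run_bind hy.
exact: leq_add.
Qed.

Lemma ok_bindv (A B : Type) (p : prog C A) (h : A -> prog C B) b1 b2 x Q :
  ok p b1 (eq x) -> ok (h x) b2 Q -> ok (bind p h) (b1 + b2) Q.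
Proof. by move=> px hx; apply: ok_bind px _ => _ <-. Qed.

Lemma ok_add x y : ok (vadd x y) 1 (eq (x + y)).
Proof. exact/ok_step/ok_ret. Qed.

Lemma ok_sub x y : ok (vsub x y) 1 (eq (x - y)).
Proof. exact/ok_step/ok_ret. Qed.

Lemma ok_mul x y : ok (vmul x y) 1 (eq (x * y)).
Proof. exact/ok_step/ok_ret. Qed.

Lemma ok_div x y : y != 0 -> ok (vdiv x y) 1 (eq (x / y)).
Proof. by move=> /negPf y0; apply/ok_step/ok_ret => //=; rewrite y0. Qed.

Lemma ok_int n : ok (vint C n) 1 (eq n%:~R).
Proof. exact/ok_step/ok_ret. Qed.

Lemma ok_root n : (0 < n)%N -> ok (vroot C n) 1 (eq (eta R n)).
Proof. by case: n => // n _; apply/ok_step/ok_ret. Qed.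

(** When each step has a result described by a relation, the list of results
    is described componentwise. *)
Lemma ok_mapM_rel (A : eqType) (B : Type) (h : A -> prog C B) (s : seq A)
    (c : A -> nat) (Q : A -> B -> Prop) :
  (forall x, x \in s -> ok (h x) (c x) (Q x)) ->
  ok (mapM h s) (\sum_(x <- s) c x) (List.Forall2 Q s).
Proof.
elim: s => [|x s IHs] hs; first by rewrite big_nil; apply: ok_ret.
rewrite big_cons /= -[X in (_ + X)%N]addn0.
apply: ok_bind (hs x (mem_head _ _)) _ => y Qy.
apply: ok_bind (IHs _) _ => [z zs|ys Qys].
  by apply: hs; rewrite inE zs orbT.
by apply: ok_ret; constructor.
Qed.

Lemma ok_mapM (A : eqType) (B : Type) (h : A -> prog C B) (s : seq A) c F :
  (forall x, x \in s -> ok (h x) c (eq (F x))) ->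
  ok (mapM h s) (size s * c) (eq (map F s)).
Proof.
move=> /ok_mapM_rel/ok_le; apply.
  by rewrite big_const_seq count_predT iter_addn_0 mulnC.
by move=> ys; elim=> //= x y s' ys' <- _ ->.
Qed.

Lemma ok_foldM (A B : Type) (h : B -> A -> prog C B) (s : seq A) (y : B) c F :
  (forall y x, ok (h y x) c (eq (F y x))) ->
  ok (foldM h y s) (size s * c) (eq (foldl F y s)).
Proof.
move=> hF; elim: s y => [|x s IHs] y; first exact: ok_ret.
by rewrite mulSn; apply: (ok_bindv (hF y x)); apply: IHs.
Qed.

Lemma ok_map2M (h : C -> C -> prog C C) H c n (f g : nat -> C) :
  (forall x y, ok (h x y) c (eq (H x y))) ->
  ok (map2M h (mkseq f n) (mkseq g n)) (n * c)
     (eq (mkseq (fun i => H (f i) (g i)) n)).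
Proof.
move=> hH; rewrite /map2M /mkseq zip_map.
have := @ok_mapM _ _ (fun xy => h xy.1 xy.2)
  [seq (f i, g i) | i <- iota 0 n] c (fun xy => H xy.1 xy.2) (fun _ _ => hH _ _).
by rewrite -map_comp size_map size_iota.
Qed.

Lemma ok_powers_from y x n :
  ok (powers_from y x n) n (eq (mkseq (fun i => y * x ^+ i) n)).
Proof.
elim: n y => [|n IHn] y; first exact: ok_ret.
apply: (ok_bindv (ok_mul y x)); rewrite -[X in ok _ X]addn0.
apply: (ok_bindv (IHn _)); apply: ok_ret.
rewrite /mkseq /= expr0 mulr1 (iotaDl 1) -map_comp; congr (_ :: _).
by apply: eq_map => i /=; rewrite exprS mulrA.
Qed.

Lemma ok_powers x n :
  ok (powers x n) n.+1 (eq (mkseq (fun i => x ^+ i) n)).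
Proof.
apply: (ok_bindv (ok_int 1)); apply: ok_le (ok_powers_from _ _ _) _ _ => // _ <-.
by apply: eq_mkseq => i; rewrite mul1r.
Qed.

Lemma ok_invfacts n :
  ok (invfacts C n) (n.*2.+1) (eq (mkseq (fun i => (i`!%:R)^-1) n)).
Proof.
apply: (ok_bindv (ok_int 1)).
have gen k : ok (invfacts_from (k`!%:R)^-1 k n) n.*2
  (eq (mkseq (fun i => (((k + i)`!)%:R)^-1) n)).
  elim: n k => [|n IHn] k; first exact: ok_ret.
  rewrite doubleS; apply: (ok_bindv (ok_int _)).
  apply: (ok_bindv (ok_div _ _)); first by rewrite pnatr_eq0.
  rewrite -invfM -natrM mulnC -factS -[X in ok _ X]addn0.
  apply: (ok_bindv (IHn k.+1)); apply: ok_ret.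
  rewrite /mkseq /= addn0 (iotaDl 1) -map_comp; congr (_ :: _).
  by apply: eq_map => i /=; rewrite addnA addn1.
by have := gen 0%N; rewrite fact0 invr1.
Qed.

End Ok.

(* Run the next instruction of the program, whose result is given by [H]; the
   bound on the cost is an existential variable that gathers the costs. *)
Tactic Notation "run_by" uconstr(H) := eapply ok_bindv; [eapply H|].

(** * Fast Fourier transform and multiplication *)

(** Up to a constant factor, the cost of multiplying polynomials of size at
    most [2 ^ j]. *)
Definition mulcost (j : nat) : nat := (j.+1 * 2 ^ j)%N.

(** Doubling the size more than doubles the cost, so that the last step of a
    Newton iteration dominates the sum of all its steps. *)
Lemma mulcostS j : (2 * mulcost j + 2 ^ j.+1 = mulcost j.+1)%N.
Proof. by rewrite /mulcost expnS; lia. Qed.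

Lemma leq_mulcost i j : (i <= j)%N -> (mulcost i <= mulcost j)%N.
Proof. by move=> leij; rewrite leq_mul // leq_pexp2l. Qed.

Lemma leq_exp_mulcost j : (2 ^ j <= mulcost j)%N.
Proof. exact: leq_pmull. Qed.

Section Multiplication.

Variable R : realType.
Local Notation C := (complex R).

Lemma ok_padd n (p q : seq C) :
  ok (padd n p q) n.+1 (eq (mkseq (fun i => p`_i + q`_i) n)).
Proof.
apply: (ok_bindv (ok_int R 0)); rewrite -[X in ok _ X]muln1.
exact: (ok_map2M n (nth 0 p) (nth 0 q) (@ok_add R)).
Qed.

Lemma ok_psub n (p q : seq C) :
  ok (psub n p q) n.+1 (eq (mkseq (fun i => p`_i - q`_i) n)).
Proof.
apply: (ok_bindv (ok_int R 0)); rewrite -[X in ok _ X]muln1.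
exact: (ok_map2M n (nth 0 p) (nth 0 q) (@ok_sub R)).
Qed.

Lemma sum_even_odd (V : nmodType) (F : nat -> V) m :
  \sum_(i < m.*2) F i = \sum_(i < m) F i.*2 + \sum_(i < m) F i.*2.+1.
Proof.
elim: m => [|m IHm]; first by rewrite !big_ord0 addr0.
by rewrite doubleS !big_ord_recr /= IHm -!addrA; congr (_ + _); rewrite addrCA.
Qed.

Lemma horner_mkseq (n : nat) (f : nat -> C) x :
  (Poly (mkseq f n)).[x] = \sum_(i < n) f i * x ^+ i.
Proof.
rewrite (@horner_coef_wide _ n); last first.
  by apply: leq_trans (size_Poly _) _; rewrite size_mkseq.
by apply: eq_bigr => i _; rewrite coef_Poly nth_mkseq.
Qed.

(** The transform evaluates a polynomial at the powers of [w].  Of the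
    primitivity of [w], only [w ^ (2 ^ (k - 1)) = -1] is needed: it passes to
    [w ^ 2], and it makes the upper half of the values differences. *)
Lemma ok_fft k (w : C) (f : nat -> C) :
  (forall k', k = k'.+1 -> w ^+ (2 ^ k') = -1) ->
  ok (fft k w (mkseq f (2 ^ k))) (6 * (k * 2 ^ k))
     (eq (mkseq (fun i => \sum_(j < 2 ^ k) f j * (w ^+ i) ^+ j) (2 ^ k))).
Proof.
elim: k w f => [|k IHk] w f wk.
  by apply: ok_ret; rewrite /mkseq /= big_ord1 expr0 mulr1.
have wk' := wk k erefl.
have w2k k' : k = k'.+1 -> (w * w) ^+ (2 ^ k') = -1.
  by move=> kE; rewrite -expr2 -exprM -expnS -kE.
have dbl : (2 ^ k.+1 = (2 ^ k).*2)%N by rewrite expnS mul2n.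
have evE b : (b < 2)%N ->
    mkseq (fun i => nth w (mkseq f (2 ^ k.+1)) (i.*2 + b)) (2 ^ k) =
    mkseq (fun i => f (i.*2 + b)%N) (2 ^ k).
  move=> b2; apply/eq_in_map => i; rewrite mem_iota => /andP [_ lti].
  by rewrite nth_mkseq //; lia.
have := evE 0%N isT; have := evE 1%N isT.
under [LHS]eq_mkseq do rewrite addn1.
under [X in _ -> X = _ -> _]eq_mkseq do rewrite addn0.
move=> od ev; rewrite /fft -/(@fft C) ev od.
eapply (@ok_le R _ _ _ _ _ (eq _)).
- run_by ok_mul; run_by (IHk _ _ w2k); run_by (IHk _ _ w2k); run_by ok_powers.
  run_by (ok_map2M _ _ _ (@ok_mul R)); run_by (ok_map2M _ _ _ (@ok_add R)).
  by run_by (ok_map2M _ _ _ (@ok_sub R)); apply: ok_ret.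
- by rewrite expnS; have := expn_gt0 2 k; nia.
move=> _ <-; apply: (@eq_from_nth _ 0).
  by rewrite size_cat !size_mkseq; lia.
rewrite size_mkseq => i lti; rewrite nth_mkseq // dbl.
rewrite (sum_even_odd (fun j => f j * w ^+ i ^+ j)) nth_cat size_mkseq.
have fold2 (x : C) j : (x * x) ^+ j = x ^+ j.*2.
  by rewrite -expr2 -exprM mul2n.
have [ltik|leki] := ltnP i (2 ^ k).
  rewrite nth_mkseq //; congr (_ + _).
    by apply: eq_bigr => j _; rewrite addn0 exprMn fold2.
  rewrite mulr_sumr; apply: eq_bigr => j _.
  by rewrite addn1 exprMn fold2 exprS mulrCA.
have ltik : (i - 2 ^ k < 2 ^ k)%N by lia.
have -> : w ^+ i = - w ^+ (i - 2 ^ k).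
  by rewrite -[in LHS](subnK leki) exprD wk' mulrN1.
rewrite nth_mkseq // mulr_sumr -sumrN; congr (_ + _).
  by apply: eq_bigr => j _; rewrite addn0 exprMn -fold2 mulrNN.
apply: eq_bigr => j _.
by rewrite addn1 exprMn exprS -fold2 mulrNN mulNr mulrN mulrCA.
Qed.

Lemma sum_unity_root (z : C) n :
  z ^+ n = 1 -> z != 1 -> \sum_(j < n) z ^+ j = 0.
Proof.
move=> zn; rewrite -subr_eq0 => z1; apply/eqP.
have := subrX1 z n; rewrite zn subrr => /esym/eqP.
by rewrite mulf_eq0 (negPf z1).
Qed.

(** Evaluating at the powers of [w^-1] the polynomial whose coefficients are the
    values of another one at the powers of [w] gives back the coefficients of
    the latter, times [n]. *)
Lemma inverse_fft n (w : C) (F : nat -> C) i :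
  n.-primitive_root w -> (i < n)%N ->
  \sum_(j < n) (\sum_(l < n) F l * (w ^+ j) ^+ l) * (w^-1 ^+ i) ^+ j = F i * n%:R.
Proof.
move=> wn ltin; have w0 := prim_root_neq0 wn.
under eq_bigr do rewrite mulr_suml.
rewrite exchange_big /= (bigD1 (Ordinal ltin)) //= [X in _ + X]big1 => [|l nli].
  rewrite addr0 mulr_natr -[n in RHS]card_ord -sumr_const; apply: eq_bigr => j _.
  by rewrite -mulrA -!exprM exprVn (mulnC i) divff ?mulr1 // expf_neq0.
under eq_bigr => j _.
  rewrite -mulrA -[(w ^+ j) ^+ l]exprM mulnC exprM -exprMn.
  over.
rewrite -mulr_sumr sum_unity_root ?mulr0 //.
  rewrite exprMn -!exprM !(mulnC _ n) !exprM exprVn (prim_expr_order wn).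
  by rewrite invr1 !expr1n mulr1.
apply: contra nli => /eqP wli; rewrite -val_eqE /=.
have : w ^+ l = w ^+ i.
  by rewrite -[RHS]mul1r -wli exprVn mulfVK ?expf_neq0.
by move/eqP; rewrite (eq_prim_root_expr wn) !modn_small.
Qed.

Lemma Poly_mkseq n (p : seq C) :
  (size p <= n)%N -> Poly (mkseq (nth 0 p) n) = Poly p.
Proof.
move=> pn; apply/polyP => i; rewrite !coef_Poly.
have [ltin|leni] := ltnP i n; first by rewrite nth_mkseq.
by rewrite !nth_default ?size_mkseq //; apply: leq_trans leni.
Qed.

Lemma ok_pmul_log n (p q : seq C) :
  ok (pmul n p q) (25 * mulcost (up_log 2 (size p + size q)))
     (fun r => size r = n /\ eqX n (Poly r) (Poly p * Poly q)).
Proof.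
rewrite /pmul; cbv zeta; set k := up_log 2 _; set N := (2 ^ k)%N.
have N0 : (0 < N)%N by rewrite expn_gt0.
have pqN : (size p + size q <= N)%N by apply: up_logP.
have wN : N.-primitive_root (eta R N) by apply: eta_prim.
set w := eta R N in wN.
have w1 : (1 : C) / w = w^-1 by rewrite mul1r.
have w0 := prim_root_neq0 wN.
have wk k' : k = k'.+1 -> w ^+ (2 ^ k') = -1.
  move=> kE; have NE : N = (2 ^ k' * 2)%N by rewrite /N kE expnSr.
  have /eqP := prim_expr_order wN.
  rewrite {1}NE exprM sqrf_eq1 => /orP [/eqP w1'|/eqP //].
  have := prim_order_dvd wN (2 ^ k'); rewrite w1' eqxx => /dvdn_leq.
  by rewrite NE expn_gt0 => /(_ isT); have := expn_gt0 2 k'; lia.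
have wk' k' : k = k'.+1 -> w^-1 ^+ (2 ^ k') = -1.
  by move=> kE; rewrite exprVn wk // invrN invr1.
have cN : (Posz N)%:~R != 0 :> C by rewrite pnatr_eq0 -lt0n.
have w1' : w^-1 = 1%:~R / w by rewrite mul1r.
rewrite {}w1' in wk'.
eapply ok_cost.
run_by ok_int; run_by ok_int.
run_by (ok_root _ N0); run_by (ok_div _ w0).
run_by (ok_fft (nth 0 p) wk).
run_by (ok_fft (nth 0 q) wk).
run_by (ok_map2M _ _ _ (@ok_mul R)).
run_by (ok_fft _ wk').
run_by ok_int.
run_by (@ok_mapM _ _ _ _ _ 1 _ (fun x _ => ok_div x cN)).
eapply ok_ret; split; first by rewrite size_mkseq.
apply: eqX_mkseq => i ltin; rewrite w1.
set P := Poly p; set Q := Poly q.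
have valP (s : seq C) x : (size s <= N)%N ->
    \sum_(j < N) s`_j * x ^+ j = (Poly s).[x].
  by move=> sN; rewrite -(Poly_mkseq sN) horner_mkseq.
have PQN : (size (P * Q)%R <= N)%N.
  apply: leq_trans (size_polyMleq _ _) _; apply: leq_trans (leq_pred _) _.
  by apply: leq_trans pqN; rewrite leq_add ?size_Poly.
have [ltiN|leNi] := ltnP i N; last first.
  by rewrite !nth_default // ?size_map ?size_iota //; apply: leq_trans leNi.
rewrite (nth_map 0) ?size_mkseq // nth_mkseq //.
under eq_bigr => j _.
  rewrite !valP; try lia; rewrite -hornerM (horner_coef_wide _ PQN); over.
by rewrite (inverse_fft (nth 0 (P * Q)) wN ltiN) mulfK.
Unshelve.
by rewrite size_mkseq /mulcost -/N; nia.
Qed.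

Lemma ok_pmul n j (p q : seq C) :
  (size p <= 2 ^ j)%N -> (size q <= 2 ^ j)%N ->
  ok (pmul n p q) (100 * mulcost j)
     (fun r => size r = n /\ eqX n (Poly r) (Poly p * Poly q)).
Proof.
move=> pj qj; apply: ok_le (ok_pmul_log n p q) _ _ => //.
have le1 : (up_log 2 (size p + size q) <= j.+1)%N.
  by apply: up_log_min => //; rewrite expnS; lia.
have := leq_mulcost le1; rewrite /mulcost [in X in (_ <= X)%N -> _]expnS.
by move: (up_log _ _) => u; move: (2 ^ u)%N => U; nia.
Qed.

End Multiplication.

(** * Inverse, logarithm and exponential of power series *)

Section LogExp.

Variable R : realType.
Local Notation C := (complex R).

Lemma ok_pinv_pow2 k (p : seq C) :
  p`_0 != 0 ->
  ok (pinv_pow2 k p) (406 * mulcost k)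
     (fun g => size g = (2 ^ k)%N /\ eqX (2 ^ k) (Poly p * Poly g) 1).
Proof.
move=> p0; elim: k => [|k IHk].
  eapply ok_cost.
    run_by ok_int; run_by ok_int; run_by (ok_div _ p0); eapply ok_ret.
    split=> // -[|//] _.
    by rewrite coef0M !coef_Poly coef1 /= mulrC divfK.
  by [].
eapply ok_cost.
  apply: ok_bind IHk _ => g [sg Hg].
  apply: ok_bind (@ok_pmul _ _ k.+1 _ _ _ _) _ => [||pg [spg Hpg]].
  - by rewrite size_take_min geq_minl.
  - by rewrite sg leq_exp2l.
  run_by ok_int; run_by ok_psub; set e := mkseq _ _.
  apply: ok_le (@ok_pmul _ _ k.+1 _ _ _ _) (leqnn _) _ => [||r [sr Hr]].
  - by rewrite sg leq_exp2l.
  - by rewrite size_mkseq.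
  split=> //.
  have N2 : (2 ^ k.+1 = 2 ^ k + 2 ^ k)%N by rewrite expnS; lia.
  have pgE : eqX (2 ^ k.+1) (Poly pg) (Poly p * Poly g).
    by apply: eqX_trans Hpg _; apply: eqXM => //; apply: eqX_take.
  have e2 : eqX (2 ^ k.+1) (Poly e) (2 - Poly p * Poly g).
    apply: eqX_mkseq => i lti; rewrite coefB -pgE // coef_Poly.
    by rewrite -polyC_natr coefC; case: i {lti} => [|i]; rewrite //= nth_nil.
  apply: (@eqX_trans _ _ (Poly p * (Poly g * (2 - Poly p * Poly g)))).
    apply: eqXM => //; apply: eqX_trans Hr _; exact: eqXM.
  by rewrite N2; apply: newton_inv.
have := mulcostS k; have := leq_exp_mulcost k.+1; lia.
Qed.

Lemma ok_pinv n j (p : seq C) :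
  p`_0 != 0 -> (n <= 2 ^ j)%N ->
  ok (Defs.pinv n p) (406 * mulcost j)
     (fun g => (size g <= n)%N /\ eqX n (Poly p * Poly g) 1).
Proof.
move=> p0 nj; rewrite /Defs.pinv; set k := up_log 2 n.
have kj : (k <= j)%N by apply: up_log_min.
have nk : (n <= 2 ^ k)%N by apply: up_logP.
eapply ok_cost.
  apply: ok_bind (ok_pinv_pow2 k p0) _ => g [sg Hg].
  apply: ok_ret; split; first by rewrite size_take_min geq_minl.
  apply: eqX_trans (eqX_le nk Hg); apply: eqXM => //; exact: eqX_take.
by rewrite addn0 leq_mul2l leq_mulcost // orbT.
Qed.

Lemma ok_mapM_index (h : nat * C -> prog C C) F (s : seq C) :
  (forall i x, ok (h (i.+1, x)) 2 (eq (F i.+1 x))) ->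
  ok (mapM h (zip (iota 1 (size s)) s)) (size s * 2)
     (eq (mkseq (fun i => F i.+1 s`_i) (size s))).
Proof.
move=> hF; have sE : s = mkseq (nth 0 s) (size s) by rewrite mkseq_nth.
have -> : zip (iota 1 (size s)) s = mkseq (fun i => (i.+1, s`_i)) (size s).
  by rewrite [in LHS]sE size_mkseq (iotaDl 1) /mkseq zip_map.
have := @ok_mapM R _ _ h (mkseq (fun i => (i.+1, s`_i)) (size s)) 2
  (fun ix => F ix.1 ix.2).
rewrite size_mkseq => H; apply: ok_le (H _) _ _ => // [ix|_ <-].
  by move=> /mapP [i _ ->]; apply: hF.
by rewrite /mkseq -map_comp.
Qed.

Lemma ok_pderiv (p : seq C) :
  ok (pderiv p) ((size p).-1 * 2)
     (fun r => size r = (size p).-1 /\ Poly r = (Poly p)^`()).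
Proof.
rewrite /pderiv -size_behead.
have := @ok_mapM_index (fun ix => bind (vint C (Posz ix.1)) (fun c => vmul c ix.2))
  (fun i x => i%:~R * x) (behead p).
move=> H; apply: ok_le (H _) _ _ => // [i x|_ <-].
  by eapply ok_cost; [run_by ok_int; apply: ok_mul|].
split; first by rewrite size_mkseq.
apply/polyP => i; rewrite coef_deriv !coef_Poly.
have [lti|lei] := ltnP i (size (behead p)).
  by rewrite nth_mkseq // nth_behead mulr_natl.
rewrite !nth_default ?mul0rn ?size_mkseq //.
by move: lei; rewrite size_behead; case: (size p).
Qed.

Lemma ok_pinteg (p : seq C) :
  ok (pinteg p) (size p * 2).+1
     (fun r => [/\ size r = (size p).+1, r`_0 = 0 & (Poly r)^`() = Poly p]).
Proof.
have := @ok_mapM_index (fun ix => bind (vint C (Posz ix.1)) (fun c => vdiv ix.2 c))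
  (fun i x => x / i%:~R) p.
move=> H; rewrite /pinteg -[X in ok _ X]addn0 -[X in ok _ (X + 0)]add1n -addnA.
run_by ok_int; eapply ok_bindv; [apply: H|].
  by move=> i x; eapply ok_cost; [run_by ok_int; apply: ok_div; rewrite intr_eq0|].
apply: ok_ret; split=> //; first by rewrite /= size_map size_iota.
apply/polyP => i; rewrite coef_deriv !coef_Poly /=.
have [lti|lei] := ltnP i (size p).
  by rewrite nth_mkseq // -[_ *+ _]mulr_natr divfK // pnatr_eq0.
by rewrite !nth_default ?mul0rn ?size_mkseq.
Qed.

Lemma ok_pln n j (p : seq C) :
  (0 < n)%N -> p`_0 != 0 -> (n <= 2 ^ j)%N ->
  ok (pln n p) (511 * mulcost j)
     (fun L => size L = n /\ is_log n (Poly p) (Poly L)).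
Proof.
move=> n0 p0 nj; have nj' : (n.-1 <= 2 ^ j)%N by lia.
have st : ((size (take n p)).-1 <= n.-1)%N.
  by rewrite size_take_min; lia.
eapply ok_cost.
  apply: ok_bind (ok_pderiv _) _ => dp [sdp dpE].
  apply: ok_bind (ok_pinv p0 nj') _ => q [sq qE].
  apply: ok_bind (@ok_pmul _ n.-1 j dp q _ _) _ => [||r [sr rE]].
  - by rewrite sdp; apply: leq_trans nj'.
  - exact: leq_trans nj'.
  apply: ok_le (ok_pinteg r) _ _; first by rewrite sr.
  move=> L [sL L0 LE]; split; first by rewrite sL sr prednK.
  split; first by rewrite coef_Poly.
  rewrite LE.
  apply: (@eqX_trans _ _ (Poly dp * (Poly p * Poly q))).
    have -> : Poly dp * (Poly p * Poly q) = Poly dp * Poly q * Poly p by ring.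
    exact: eqXM.
  rewrite dpE -[X in eqX _ _ X]mulr1; apply: eqXM => //.
  by apply: eqX_deriv; apply: eqX_take.
have := leq_exp_mulcost j; lia.
Qed.

Lemma ok_pexp_pow2 k (h : seq C) :
  h`_0 = 0 ->
  ok (pexp_pow2 k h) (1232 * mulcost k)
     (fun g => size g = (2 ^ k)%N /\ is_exp (2 ^ k) (Poly h) (Poly g)).
Proof.
move=> h0; elim: k => [|k IHk].
  eapply ok_cost.
    run_by ok_int; apply: ok_ret; split=> //; split=> //.
    by rewrite coef_Poly.
  by [].
eapply ok_cost.
  apply: ok_bind IHk _ => g [sg Hg].
  have g0 : g`_0 != 0.
    by case: Hg => [+ _]; rewrite coef_Poly => ->; apply: oner_neq0.
  apply: ok_bind (ok_pln (expn_gt0 2 k.+1) g0 (leqnn _)) _ => l [sl Hl].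
  run_by ok_psub; run_by ok_int; run_by ok_padd; set e := mkseq _ _.
  apply: ok_le (@ok_pmul _ _ k.+1 _ _ _ _) (leqnn _) _ => [||r [sr Hr]].
  - by rewrite sg leq_exp2l.
  - by rewrite size_mkseq.
  split=> //; have N0 : (0 < 2 ^ k.+1)%N by rewrite expn_gt0.
  have eE : eqX (2 ^ k.+1) (Poly e) (1 + (Poly h - Poly l)).
    apply: eqX_mkseq => i lti; rewrite coefD coefB !coef_Poly nth_mkseq // coef1.
    by case: i {lti} => [|i]; rewrite //= nth_nil.
  apply: (@is_exp_eqX _ _ _ (Poly g * (1 + (Poly h - Poly l)))) => //.
    by apply: eqX_sym; apply: eqX_trans Hr _; apply: eqXM.
  have N2 : (2 ^ k.+1 = 2 ^ k + 2 ^ k)%N by rewrite expnS; lia.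
  rewrite N2 in Hl *; apply: newton_exp => //; first by rewrite expn_gt0.
  by rewrite coef_Poly.
have := mulcostS k; have := leq_exp_mulcost k.+1; lia.
Qed.

Lemma ok_pexp n j (h : seq C) :
  h`_0 = 0 -> (0 < n <= 2 ^ j)%N ->
  ok (pexp n h) (1232 * mulcost j)
     (fun g => size g = n /\ is_exp n (Poly h) (Poly g)).
Proof.
move=> h0 /andP [n0 nj]; rewrite /pexp; set k := up_log 2 n.
have kj : (k <= j)%N by apply: up_log_min.
have nk : (n <= 2 ^ k)%N by apply: up_logP.
eapply ok_cost.
  apply: ok_bind (ok_pexp_pow2 k h0) _ => g [sg Hg].
  apply: ok_ret; split; first by rewrite size_take_min sg (minn_idPl nk).
  apply: is_exp_eqX n0 _ (is_exp_le nk Hg); apply: eqX_sym; exact: eqX_take.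
by rewrite addn0 leq_mul2l leq_mulcost // orbT.
Qed.

(** The series [e ^ s] modulo [s ^ n]. *)
Definition exp_series n : {poly C} := \poly_(i < n) (i`!%:R)^-1.

(** The series [(e ^ s - 1) / s] modulo [s ^ n], the inverse of [g(s)]. *)
Definition g_inv n : {poly C} := \poly_(i < n) (i.+1`!%:R)^-1.

(** The series [1 - y (e ^ s - 1)] modulo [s ^ n], the inverse of [g(s, y)]. *)
Definition gy_inv n (y : C) : {poly C} := 1 - y *: (exp_series n - 1).

Lemma ok_pneg n (L : seq C) : size L = n ->
  ok (psub n [::] L) n.+1 (fun l => size l = n /\ - Poly l = Poly L).
Proof.
move=> sL; apply: ok_le (ok_psub n [::] L) (leqnn _) _ => _ <-.
split; first by rewrite size_mkseq.
apply/polyP => i; rewrite coefN !coef_Poly.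
have [lti|lei] := ltnP i n; first by rewrite nth_mkseq // nth_nil sub0r opprK.
by rewrite !nth_default ?oppr0 ?size_mkseq ?sL.
Qed.

Lemma ok_ln_g n j :
  (0 < n <= 2 ^ j)%N ->
  ok (ln_g C n) (518 * mulcost j)
     (fun l => size l = n /\ is_log n (g_inv n) (- Poly l)).
Proof.
move=> /andP [n0 nj]; rewrite /ln_g.
eapply ok_cost.
  run_by ok_invfacts.
  have b0 : (behead (mkseq (fun i => (i`!%:R)^-1 : C) n.+1))`_0 != 0.
    by rewrite nth_behead nth_mkseq // invr_eq0 pnatr_eq0.
  apply: ok_bind (ok_pln n0 b0 nj) _ => L [sL HL].
  apply: ok_le (ok_pneg sL) (leqnn _) _ => l [sl ->]; split=> //.
  apply: is_log_eqX HL => i lti.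
  by rewrite coef_Poly nth_behead nth_mkseq // coef_poly lti.
have := leq_exp_mulcost j; lia.
Qed.

Lemma ok_ln_gy n j y :
  (0 < n <= 2 ^ j)%N ->
  ok (ln_gy n y) (519 * mulcost j)
     (fun l => size l = n /\ is_log n (gy_inv n y) (- Poly l)).
Proof.
move=> /andP [n0 nj]; rewrite /ln_gy.
eapply ok_cost.
  run_by ok_invfacts; run_by ok_int; run_by ok_int; run_by ok_sub.
  run_by (@ok_mapM R _ _ _ _ 1 _ (fun x _ => ok_mul _ x)).
  set t := _ :: _.
  have t0 : t`_0 != 0 by apply: oner_neq0.
  apply: ok_bind (ok_pln n0 t0 nj) _ => L [sL HL].
  apply: ok_le (ok_pneg sL) (leqnn _) _ => l [sl ->]; split=> //.
  apply: is_log_eqX HL => i lti.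
  rewrite coef_Poly /t coefB coefZ coefB coef1 coef_poly lti.
  case: i lti => [|i] lti /=.
    by rewrite fact0 invr1 subrr mulr0 subr0.
  rewrite (nth_map 0) ?size_behead ?size_mkseq; last by lia.
  by rewrite nth_behead nth_mkseq // subr0 !sub0r mulNr.
rewrite ?size_behead ?size_mkseq; have := leq_exp_mulcost j; lia.
Qed.

End LogExp.

(** * The log-exponential method *)

Section Tree.

Variable R : realType.
Local Notation C := (complex R).

(** One level of a product tree: factors of degree at most [2 ^ l] are
    multiplied two by two, modulo [s ^ n]. *)
Lemma ok_prod_pairs n j l (ps : seq (seq C)) :
  (n <= 2 ^ j)%N -> all (fun p => size p <= minn n (2 ^ l).+1)%N ps ->
  ok (prod_pairs n ps) ((size ps)./2 * (100 * mulcost (minn l.+1 j)))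
     (fun rs => [/\ size rs = uphalf (size ps),
        all (fun p => size p <= minn n (2 ^ l.+1).+1)%N rs
      & eqX n (\prod_(r <- rs) Poly r) (\prod_(p <- ps) Poly p)]).
Proof.
move=> nj; have l2 : (minn n (2 ^ l).+1 <= 2 ^ minn l.+1 j)%N.
  have := expn_gt0 2 l; have := expnS 2 l.
  by case: (leqP l.+1 j) => lj; rewrite ?(minn_idPl lj) ?(minn_idPr (ltnW lj)); lia.
have l1 : (minn n (2 ^ l).+1 <= minn n (2 ^ l.+1).+1)%N.
  by have := expnS 2 l; lia.
have [m] := ubnP (size ps); elim: m ps => // m IHm [|p [|q ps]] /= ltm.
- by move=> _; apply: ok_ret.
- move=> /andP [sp _]; apply: ok_ret; split=> //=.
  by rewrite andbT; apply: leq_trans l1.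
move=> /and3P [sp sq sps]; rewrite mulSn -[X in ok _ (_ + X)%N]addn0.
apply: ok_bind (ok_pmul _ _ _) _ => [||r [sr rE]].
- exact: leq_trans l2.
- exact: leq_trans l2.
apply: ok_bind (IHm ps _ sps) _ => [|rs [srs ars rsE]]; first by lia.
apply: ok_ret; split; first by rewrite /= srs.
  by rewrite /= ars andbT sr; move: sp sq; have := expnS 2 l; lia.
rewrite !big_cons mulrA; apply: eqXM => // i lti.
(* Cutting the product at its formal size loses no coefficient. *)
have [ltis|leis] := ltnP i (size p + size q).-1.
  by rewrite rE // leq_min lti.
rewrite !nth_default //.
  apply: leq_trans leis; apply: leq_trans (size_polyMleq _ _) _.
  by rewrite -!subn1 leq_sub2r // leq_add ?size_Poly.
by apply: leq_trans (size_Poly _) _; rewrite sr; lia.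
Qed.

(** A bound on the cost of a product tree, per leaf, when the leaves have degree
    at most [2 ^ l] and the products are truncated to size at most [2 ^ j].
    Below the truncation, each of the [j - l] levels costs about [j] operations
    per unit of degree; at size [2 ^ j], the number of factors is halved at each
    level for a constant cost per factor. *)
Definition treecost (j l : nat) : nat :=
  (200 * (j.+1 * (2 ^ minn l j * (j - l).+1)))%N.

Lemma treecostS j l :
  (2 * (100 * mulcost (minn l.+1 j)) + treecost j l.+1 <= 2 * treecost j l)%N.
Proof.
rewrite /treecost /mulcost; have [lj|jl] := boolP (l < j)%N.
  rewrite (minn_idPl lj) (minn_idPl (ltnW lj)) expnS.
  have -> : (j - l = (j - l.+1).+1)%N by lia.
  have : (l.+2 <= j.+1)%N by lia.
  move: (j - l.+1)%N (2 ^ l)%N (j.+1) => d N J; nia.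
rewrite -leqNgt in jl; rewrite (minn_idPr jl) (minn_idPr (leqW jl)).
have -> : (j - l = 0)%N by lia.
have -> : (j - l.+1 = 0)%N by lia.
lia.
Qed.

Lemma ok_prod_tree n j l k (ps : seq (seq C)) :
  (n <= 2 ^ j)%N -> all (fun p => size p <= minn n (2 ^ l).+1)%N ps ->
  (0 < size ps <= 2 ^ k)%N ->
  ok (prod_tree k n ps) ((size ps).-1 * treecost j l)
     (fun rs => exists2 r, rs = [:: r] & eqX n (Poly r) (\prod_(p <- ps) Poly p)).
Proof.
move=> nj; elim: k l ps => [|k IHk] l ps sps /andP [ps0 psk].
  case: ps sps ps0 psk => [|p [|q ps]] //= _ _ _; apply: ok_ret; exists p => //.
  by rewrite big_seq1.
eapply ok_cost.
  apply: ok_bind (ok_prod_pairs nj sps) _ => rs [srs ars rsE].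
  apply: ok_le (IHk _ _ ars _) _ _; first by rewrite srs; rewrite expnS in psk; lia.
    by rewrite srs; apply: leqnn.
  move=> _ [r -> rE]; exists r => //; exact: eqX_trans rsE.
have := treecostS j l.
move: (100 * _)%N (treecost j l.+1) (treecost j l) (size ps) ps0 => c t' t m m0 H.
(* A level with m factors has m / 2 products and leaves uphalf m factors. *)
have h1 : (m./2 <= m.-1)%N by lia.
have h2 : (2 * (uphalf m).-1 <= m.-1)%N by lia.
have := leq_mul h1 (leqnn (2 * c)); have := leq_mul h2 (leqnn t').
have := leq_mul (leqnn m.-1) H; rewrite mulnDr; lia.
Qed.

Lemma ok_prod_linear n j (B : seq nat) :
  (n <= 2 ^ j)%N ->
  ok (prod_linear C n B) (1 + 201 * (size B * j.+1 ^ 2))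
     (fun p => eqX n (Poly p) (\prod_(b <- B) (1 - b%:R *: 'X))).
Proof.
move=> nj.
have [->|B0] := eqVneq B [::].
  eapply ok_cost.
    run_by ok_int; apply: ok_ret; rewrite big_nil => -[|i] _.
      by rewrite coef_Poly coef1.
    by rewrite coef_Poly coef1 /= nth_nil.
  by [].
eapply ok_cost.
  run_by ok_int.
  eapply ok_bindv.
    apply: (@ok_mapM R nat _ _ B 1
      (fun b : nat => take n [:: 1%:~R; (- b%:Z)%:~R])).
    by move=> b _; eapply ok_cost; [run_by ok_int; apply: ok_ret|].
  set ps := map _ _.
  have aps : all (fun p => size p <= minn n (2 ^ 0).+1)%N ps.
    by apply/allP => _ /mapP [b _ ->]; rewrite size_take_min.
  have sps : (0 < size ps <= 2 ^ up_log 2 (size B))%N.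
    by rewrite size_map lt0n size_eq0 B0 up_logP.
  apply: ok_bind (ok_prod_tree nj aps sps) _ => _ [r -> rE].
  apply: ok_ret; apply: eqX_trans rE _; rewrite big_map; apply: eqX_prod => b.
  apply: eqX_trans (@eqX_take _ _ _) _ => i _.
  rewrite coef_Poly coefB coef1 coefZ coefX; case: i => [|[|i]] /=.
  - by rewrite mulr0 subr0.
  - by rewrite mulr1 sub0r mulrNz.
  - by rewrite nth_nil mulr0 subr0.
rewrite size_map /treecost min0n subn0 mul1n addn0 muln1 mulnn.
by move: (j.+1 ^ 2)%N (expn_gt0 j.+1 2) => q q0; move: (size B) => m; nia.
Qed.

Lemma coef0_prod1 (I : Type) (s : seq I) (F : I -> {poly C}) :
  (forall i, (F i)`_0 = 1) -> (\prod_(i <- s) F i)`_0 = 1.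
Proof.
move=> F1; elim: s => [|i s IHs]; first by rewrite big_nil coef1.
by rewrite big_cons coef0M F1 IHs mulr1.
Qed.

(** If [- l] is the logarithm of [p], the result [r] is [\sum_b l (b s)], that is,
    [- r] is the logarithm of [\prod_b p (b s)].  The power sums of [B] are read
    off the logarithm of [\prod_b (1 - b s)], by uniqueness of the latter. *)
Lemma ok_sum_scaled n j (l : seq C) (B : seq nat) p :
  (0 < n <= 2 ^ j)%N -> size l = n -> is_log n p (- Poly l) ->
  ok (sum_scaled n l B) (515 * mulcost j + 201 * (size B * j.+1 ^ 2))
     (fun r => size r = n /\
        is_log n (\prod_(b <- B) (p \Po (b%:R *: 'X))) (- Poly r)).
Proof.
move=> /andP [n0 nj] sl Hl; eapply ok_cost.
  apply: ok_bind (ok_prod_linear B nj) _ => P PE.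
  have B01 : (\prod_(b <- B) (1 - b%:R *: 'X) : {poly C})`_0 = 1.
    by apply: coef0_prod1 => b; rewrite coefB coef1 coefZ coefX mulr0 subr0.
  have P0 : P`_0 != 0.
    by rewrite -[P`_0]coef_Poly PE // B01 oner_neq0.
  apply: ok_bind (ok_pln n0 P0 nj) _ => q [sq Hq].
  have qE : eqX n (Poly q) (\sum_(b <- B) \poly_(k < n) (- (b%:R ^+ k / k%:R))).
    apply: (@is_log_uniq _ _ (\prod_(b <- B) (1 - b%:R *: 'X))).
    - by rewrite B01 oner_neq0.
    - exact: is_log_eqX Hq.
    - by apply: is_log_prod => b; apply: is_log_linear.
  have -> : zip (iota 0 n) (zip q l) = mkseq (fun i => (i, (q`_i, l`_i))) n.
    rewrite -[in LHS](mkseq_nth 0 l) -[in LHS](mkseq_nth 0 q) sq sl.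
    by rewrite /mkseq zip_map -[X in zip X _]map_id zip_map.
  eapply ok_le.
  - apply: (@ok_mapM R _ _ _ _ 3 (fun kx : nat * (C * C) =>
      (- kx.1%:Z)%:~R * kx.2.1 * kx.2.2)) => kx _.
    by eapply ok_cost; [run_by ok_int; run_by ok_mul; apply: ok_mul|].
  - by rewrite size_mkseq; apply: leqnn.
  move=> _ <-; rewrite size_map size_mkseq; split=> //.
  have [L0 _] := Hl.
  have rE : eqX n (- Poly [seq (- kx.1%:Z)%:~R * kx.2.1 * kx.2.2 | kx <-
      mkseq (fun i => (i, (q`_i, l`_i))) n])
      (\sum_(b <- B) ((- Poly l) \Po (b%:R *: 'X))).
    move=> i lti; rewrite coefN coef_Poly (nth_map (0%N, (0, 0))) ?size_mkseq //.
    have -> : (\sum_(b <- B) ((- Poly l) \Po (b%:R *: 'X)))`_i =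
        \sum_(b <- B) (b%:R ^+ i * - l`_i).
      rewrite coef_sum; apply: eq_bigr => b _.
      by rewrite coef_scaleX coefN coef_Poly.
    have qiE : q`_i = \sum_(b <- B) (- (b%:R ^+ i / i%:R)).
      rewrite -[LHS]coef_Poly qE // coef_sum; apply: eq_bigr => b _.
      by rewrite coef_poly lti.
    rewrite nth_mkseq //= qiE {qiE}.
    case: i lti => [|i] lti.
      rewrite !mul0r oppr0 big1 // => b _.
      by rewrite expr0 -[l`_0]coef_Poly -coefN L0 mulr0.
    rewrite mulrNz !mulNr opprK mulrAC mulr_sumr; apply: eq_bigr => b _.
    have i0 : i.+1%:R != 0 :> C by rewrite pnatr_eq0.
    by rewrite -[(Posz i.+1)%:~R]/(i.+1%:R); field.
  apply: is_log_eqXr n0 (eqX_sym rE) _.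
  by apply: is_log_prod => b; apply: is_log_scaleX.
by have := leq_exp_mulcost j; lia.
Qed.

End Tree.

Section LogExpProd.

Variable R : realType.
Local Notation C := (complex R).

(** Adding up series that are minus the logarithms of given ones gives minus the
    logarithm of their product. *)
Lemma ok_foldM_padd n j (Bs : seq (C * seq nat)) (hs : seq (seq C))
    (p : {poly C}) (h : seq C) :
  (0 < n <= 2 ^ j)%N -> is_log n p (- Poly h) -> size h = n ->
  List.Forall2 (fun yB h => size h = n /\
    is_log n (\prod_(b <- yB.2) (gy_inv n yB.1 \Po (b%:R *: 'X))) (- Poly h))
    Bs hs ->
  ok (foldM (padd n) h hs) (size Bs * (2 * mulcost j))
     (fun r => size r = n /\
        is_log n (p * \prod_(yB <- Bs) \prod_(b <- yB.2)
          (gy_inv n yB.1 \Po (b%:R *: 'X))) (- Poly r)).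
Proof.
move=> /andP [n0 nj] Hp sh HB.
elim: HB p h Hp sh => [|yB h' Bs' hs' [sh' Hh'] _ IH] p h Hp sh.
  by apply: ok_ret; rewrite big_nil mulr1.
eapply ok_cost.
  run_by ok_padd; set g := mkseq _ _.
  have gE : eqX n (- Poly g) (- Poly h - Poly h').
    move=> i lti; rewrite -opprD !coefN coefD !coef_Poly nth_mkseq //.
  rewrite big_cons mulrA; apply: IH; last by rewrite size_mkseq.
  by apply: is_log_eqXr n0 (eqX_sym gE) _; apply: is_logM.
rewrite /= mulSn leq_add2r; have := leq_exp_mulcost j; lia.
Qed.

(** The result [A] is the product of the factors [g(b s)] and [g(b s, y)] modulo
    [s ^ n]: its product with their inverses is [1]. *)
Lemma ok_log_exp n j (B0 : seq nat) (Bs : seq (C * seq nat)) :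
  (0 < n <= 2 ^ j)%N ->
  ok (log_exp n B0 Bs)
     (2265 * ((size Bs).+1 * mulcost j) +
      201 * ((size B0 + \sum_(yB <- Bs) size yB.2) * j.+1 ^ 2))
     (fun A => size A = n /\
        eqX n ((\prod_(b <- B0) (g_inv R n \Po (b%:R *: 'X))) *
               (\prod_(yB <- Bs) \prod_(b <- yB.2)
                  (gy_inv n yB.1 \Po (b%:R *: 'X))) * Poly A) 1).
Proof.
move=> nj; have /andP [n0 _] := nj; eapply ok_cost.
  apply: ok_bind (ok_ln_g _ nj) _ => l0 [sl0 Hl0].
  apply: ok_bind (ok_sum_scaled _ nj sl0 Hl0) _ => h0 [sh0 Hh0].
  eapply ok_bind.
    apply: (@ok_mapM_rel R _ _ _ Bs
      (fun yB => 1034 * mulcost j + 201 * (size yB.2 * j.+1 ^ 2))%N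
      (fun yB h => size h = n /\ is_log n
         (\prod_(b <- yB.2) (gy_inv n yB.1 \Po (b%:R *: 'X))) (- Poly h))) => yB _.
    eapply ok_cost.
      apply: ok_bind (ok_ln_gy _ nj) _ => l [sl Hl].
      exact: (ok_sum_scaled yB.2 nj sl Hl).
    by rewrite addnA -mulnDl.
  move=> hs Hhs.
  apply: ok_bind (ok_foldM_padd nj Hh0 sh0 Hhs) _ => h [sh Hh].
  have h00 : h`_0 = 0.
    by case: Hh => + _; rewrite coefN coef_Poly => /eqP; rewrite oppr_eq0 => /eqP.
  apply: ok_le (ok_pexp h00 nj) (leqnn _) _ => A [sA HA]; split=> //.
  apply: is_exp_inv Hh _ HA; last by rewrite opprK.
  rewrite coef0M coef0_prod1 ?coef0_prod1 ?mulr1 // => [yB|b].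
    apply: coef0_prod1 => b; rewrite coef_scaleX expr0 mul1r.
    rewrite coefB coefZ coefB coef_poly coef1 /= n0.
    by rewrite fact0 invr1 subrr mulr0 subr0.
  by rewrite coef_scaleX expr0 mul1r coef_poly n0 invr1.
rewrite big_split /= big_const_seq count_predT iter_addn_0.
rewrite -big_distrr /= -big_distrl /=.
rewrite mulnDl; lia.
Qed.

End LogExpProd.

(** * The algorithm Float-Denum *)

Section Grouping.

Variables (V : Type) (idx : V) (op : Monoid.com_law idx).

(** Iterating over a sequence group by group, the groups being the fibres of
    [r]. *)
Lemma big_undup_fibres (s : seq nat) (r : nat -> nat) (G : nat -> nat -> V) :
  \big[op/idx]_(c <- undup (map r s)) \big[op/idx]_(b <- s | r b == c) G c b =
  \big[op/idx]_(b <- s) G (r b) b.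
Proof.
rewrite (exchange_big_dep xpredT) //= big_seq [RHS]big_seq.
apply: eq_bigr => b bs; rewrite -big_filter.
rewrite (eq_filter (_ : _ =1 pred1 (r b))); last by move=> c; rewrite /= eq_sym.
rewrite filter_pred1_uniq ?undup_uniq ?big_seq1 //.
by rewrite mem_undup map_f.
Qed.

End Grouping.

Section FloatDenumRun.

Variable R : realType.
Local Notation C := (complex R).

Lemma foldl_mul (I : Type) (F : I -> C) (x : C) s :
  foldl (fun x i => x * F i) x s = x * \prod_(i <- s) F i.
Proof.
elim: s x => [|y s IHs] x; first by rewrite big_nil mulr1.
by rewrite /= IHs big_cons mulrA.
Qed.

(** The inverse, modulo [s ^ n], of the product of the factors [g(b s)] and
    [g(b s, y_b)] attached to the [f]-th root of unity [z]. *)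
Definition denum_series (n f : nat) (a : seq nat) (z : C) : {poly C} :=
  (\prod_(b <- a | (f %| b)%N) (g_inv R n \Po (b%:R *: 'X))) *
  \prod_(b <- a | ~~ (f %| b)%N)
    (gy_inv n (z ^+ b / (1 - z ^+ b)) \Po (b%:R *: 'X)).

(** The constant factor [\prod_b 1 / (1 - z ^ b)], over the [b] not divisible
    by [f]. *)
Definition unit_factor (f : nat) (a : seq nat) (z : C) : C :=
  \prod_(b <- a | ~~ (f %| b)%N) (1 - z ^+ b)^-1.

(** The contribution of one primitive root.  The numbers [A_k(f, j)] are the
    coefficients of the inverse [A] of [denum_series]; the column of index [i]
    holds the power [z ^ (f - (i + 1)) = z ^ - (i + 1)]. *)
Lemma ok_float_denum_root f (a : seq nat) (z : C) j :
  let d := count (dvdn f) a in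
  f.-primitive_root z -> (0 < d <= 2 ^ j)%N ->
  exists2 A : {poly C}, eqX d (denum_series d f a z * A) 1 &
    ok (float_denum_root f a z)
      (4535 * (f * mulcost j) + 205 * (size a * j.+1 ^ 2))
      (eq (mkseq (fun m => mkseq (fun i =>
         A`_(d - m.+1) * unit_factor f a z * z ^+ (f - i.+1)) f) d)).
Proof.
move=> d zf dj; have f0 := prim_order_gt0 zf.
set a1 := [seq b <- a | (f %| b)%N]; set a2 := [seq b <- a | ~~ (f %| b)%N].
have a2P b : b \in a2 -> 1 - z ^+ b != 0.
  by rewrite mem_filter => /andP [fb _]; apply: prim_root_neq1 zf fb.
pose y c := z ^+ c / (1 - z ^+ c).
pose Bs := [seq (y c, [seq b <- a2 | (b %% f)%N == c])
           | c <- undup [seq (b %% f)%N | b <- a2]].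
suff [c [r [rd cB [A HA rE]]]] : ok (float_denum_root f a z)
    (4535 * (f * mulcost j) + 205 * (size a * j.+1 ^ 2))
    (fun r => exists2 A : {poly C}, eqX d (denum_series d f a z * A) 1 &
       r = mkseq (fun m => mkseq (fun i =>
         A`_(d - m.+1) * unit_factor f a z * z ^+ (f - i.+1)) f) d).
  by exists A => //; exists c, r; split.
eapply ok_cost.
  run_by ok_powers; run_by ok_int.
  eapply ok_bindv.
    apply: (@ok_mapM R _ _ _ a2 3 (fun b => (b, ((1 - z ^+ b)^-1, y b)))) => b ba2.
    rewrite nth_mkseq ?ltn_mod // (prim_expr_mod zf).
    have b0 := a2P _ ba2.
    eapply ok_cost.
      run_by ok_sub; run_by (ok_div _ b0); run_by (ok_div _ b0); apply: ok_ret.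
      by rewrite mul1r.
    by [].
  set uy := map _ a2.
  have -> : [seq ((head (0%N, (z, z)) [seq x <- uy | (x.1 %% f)%N == c]).2.2,
          [seq x.1 | x <- [seq x <- uy | (x.1 %% f)%N == c]])
       | c <- undup [seq (b %% f)%N | b <- a2]] = Bs.
    (* The group of c is not empty, so that the default of head is not used. *)
    apply/eq_in_map => c; rewrite mem_undup => /mapP [b ba2 cE].
    rewrite /uy filter_map -map_comp map_id_in //=; congr (_, _).
    have : b \in [seq b <- a2 | (b %% f)%N == c] by rewrite mem_filter cE eqxx.
    case E: [seq b <- a2 | _] => [//|b' s] _ /=.
    have : b' \in [seq b <- a2 | (b %% f)%N == c] by rewrite E mem_head.
    by rewrite mem_filter => /andP [/eqP <- _]; rewrite /y !(prim_expr_mod zf).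
  apply: ok_bind (ok_log_exp a1 Bs dj) _ => A [sA HA].
  eapply ok_bindv.
    exact: (@ok_foldM R _ _ _ _ _ 1 *%R (@ok_mul R)).
  set u := foldl _ _ _.
  have uE : u = unit_factor f a z.
    by rewrite /u (foldl_mul id) mul1r /uy -map_comp big_map big_filter.
  eapply ok_le.
  - apply: (@ok_mapM R _ _ _ _ f.+1 (fun m =>
      mkseq (fun i => A`_(d - m.+1) * unit_factor f a z * z ^+ (f - i.+1)) f)) => m.
    rewrite mem_iota => /andP [_ ltmd].
    eapply ok_cost.
      run_by ok_mul.
      apply: ok_le (@ok_mapM R _ _ _ _ 1 _ (fun x _ => ok_mul _ x)) (leqnn _) _.
      move=> _ <-; apply: (@eq_from_nth _ 0).
        by rewrite !(size_map, size_rev, size_iota).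
      move=> i; rewrite size_mkseq => ltif; rewrite nth_mkseq //.
      rewrite (nth_map 0) ?size_rev ?size_mkseq // nth_rev ?size_mkseq //.
      rewrite nth_mkseq; last by lia.
      by rewrite uE (set_nth_default 0) // sA -/d; lia.
    by rewrite size_rev size_mkseq muln1.
  - by rewrite size_iota -/d; apply: leqnn.
  move=> _ <-; exists (Poly A); last first.
    by apply: eq_mkseq => m; apply: eq_mkseq => i; rewrite coef_Poly.
  apply: eqX_trans HA; rewrite /denum_series -/d -(big_filter a) -(big_filter a).
  have -> : \prod_(yB <- Bs) \prod_(b <- yB.2) (gy_inv d yB.1 \Po (b%:R *: 'X)) =
      \prod_(b <- a2) (gy_inv d (y b) \Po (b%:R *: 'X)).
    transitivity (\prod_(b <- a2) (gy_inv d (y (b %% f)%N) \Po (b%:R *: 'X))).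
      rewrite /Bs big_map /=; under eq_bigr do rewrite big_filter.
      exact: (big_undup_fibres _ a2 (modn^~ f)
        (fun c b => gy_inv d (y c) \Po (b%:R *: 'X))).
    by apply: eq_bigr => b _; rewrite /y (prim_expr_mod zf).
  by [].
have sN : (size a1 + size a2 = size a)%N by rewrite !size_filter count_predC.
have sB : (\sum_(yB <- Bs) size yB.2 = size a2)%N.
  rewrite /Bs big_map /=.
  under eq_bigr do rewrite -sum1_size big_filter.
  by rewrite (big_undup_fibres _ a2 (modn^~ f) (fun _ _ => 1%N)) sum1_size.
have sU : (size Bs <= f)%N.
  rewrite size_map -[X in (_ <= X)%N](size_iota 0 f); apply: uniq_leq_size.
    exact: undup_uniq.
  by move=> c; rewrite mem_undup mem_iota => /mapP [b _ ->]; rewrite /= ltn_mod.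
rewrite sB sN !size_map; rewrite size_map in sU.
have := leq_exp_mulcost j; have dj' : (d <= 2 ^ j)%N by case/andP: dj.
have := expn_gt0 j.+1 2.
move: (size (undup _)) sU (mulcost j) (2 ^ j)%N dj' (j.+1 ^ 2)%N.
clearbody d; move: dj => /andP [d0 _]; clear -f0 sN d0 => B Bf M N dN q q0 NM.
have h1 : (B.+1 * M <= 2 * (f * M))%N by nia.
have h2 : (f <= f * M)%N by nia.
have h3 : (d * f.+1 <= 2 * (f * M))%N by nia.
have h4 : (size a2 <= size a * q)%N by nia.
have h5 : (1 <= f * M)%N by nia.
clear -h1 h2 h3 h4 h5.
move: (B.+1 * M)%N (f * M)%N (d * f.+1)%N (size a2) (size a * q)%N
  h1 h2 h3 h4 h5 => X1 X2 X3 X4 X5 h1 h2 h3 h4 h5.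
lia.
Qed.

Lemma prod_dvd_neq0 f (a : seq nat) : all (fun b => 0 < b)%N a ->
  \prod_(b <- a | (f %| b)%N) b%:R != 0 :> C.
Proof.
move=> a0; rewrite prodf_seq_neq0; apply/allP => b ba; apply/implyP => _.
by rewrite pnatr_eq0 -lt0n (allP a0).
Qed.

Lemma size_coprime_iota f : (0 < f)%N ->
  size [seq j <- iota 1 f | coprime j f] = totient f.
Proof.
case: f => // f _; rewrite size_filter totient_count_coprime.
have -> r : (\sum_(d <- r) coprime f.+1 d = count (coprime f.+1) r)%N.
  by elim: r => [|d r IHr]; rewrite ?big_nil // big_cons IHr.
rewrite /index_iota subn0 (eq_count (coprime_sym^~ f.+1)).
rewrite -[X in iota 1 X]addn1 iotaD count_cat /= add1n addn0 addnC.
by congr addn; rewrite /coprime gcdnn gcdn0.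
Qed.

(** The table, with [n] rows of size [f], of the values of a function. *)
Definition table (n f : nat) (g : nat -> nat -> C) : seq (seq C) :=
  mkseq (fun m => mkseq (g m) f) n.

Lemma ok_sum_tables n f (gs : seq (nat -> nat -> C)) g :
  ok (foldM (fun s t => mapM (fun xy => map2M (@vadd C) xy.1 xy.2) (zip s t))
       (table n f g) (map (table n f) gs))
     (size gs * (n * f))
     (eq (table n f (fun m i => g m i + \sum_(h <- gs) h m i))).
Proof.
elim: gs g => [|h gs IHgs] g /=.
  by apply: ok_ret; do 2!apply: eq_mkseq => ?; rewrite big_nil addr0.
rewrite mulSn; eapply ok_bindv; last first.
  apply: ok_le (IHgs (fun m i => g m i + h m i)) (leqnn _) _ => _ <-.
  by apply: eq_mkseq => m; apply: eq_mkseq => i; rewrite big_cons addrA.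
rewrite /table /mkseq zip_map -/mkseq.
have := @ok_mapM R _ _ (fun xy => map2M (@vadd C) xy.1 xy.2)
  [seq (mkseq (g m) f, mkseq (h m) f) | m <- iota 0 n] f
  (fun xy => mkseq (fun i => xy.1`_i + xy.2`_i) f).
rewrite size_map size_iota => H; apply: ok_le (H _) (leqnn _) _ => [xy|_ <-].
  move=> /mapP [m _ ->] /=.
  have := ok_map2M f (g m) (h m) (@ok_add R); rewrite muln1 => H'.
  apply: ok_le H' (leqnn _) _ => _ <-.
  apply/eq_in_map => i; rewrite mem_iota => /andP [_ lti].
  by rewrite !nth_mkseq.
rewrite -map_comp; apply: eq_map => m /=.
apply/eq_in_map => i; rewrite mem_iota => /andP [_ lti].
by rewrite !nth_mkseq.
Qed.

(** The coefficient of [t ^ m] in [P_(i + 1)], in terms of the series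
    [A j], indexed by the primitive roots [eta_f ^ j]. *)
Definition denum_coef (f : nat) (a : seq nat) (A : nat -> {poly C})
    (i m : nat) : C :=
  let d := count (dvdn f) a in
  (-1) ^+ (d + m).+1 / m`!%:R / (\prod_(b <- a | (f %| b)%N) b%:R) *
  \sum_(j <- [seq j <- iota 1 f | coprime j f])
    (A j)`_(d - m.+1) * unit_factor f a (eta R f ^+ j) *
    (eta R f ^+ j) ^+ (f - i.+1).

(** The result and the cost of Float-Denum; the cost is dominated by the
    [totient f] calls to [float_denum_root]. *)
Lemma ok_float_denum f (a : seq nat) j :
  let d := count (dvdn f) a in
  (0 < f)%N -> (0 < d <= 2 ^ j)%N -> all (fun b => 0 < b)%N a ->
  exists2 A : nat -> {poly C},
    forall k, coprime k f ->
      eqX d (denum_series d f a (eta R f ^+ k) * A k) 1 &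
    ok (float_denum C f a)
      (4560 * ((f * mulcost j + size a * j.+1 ^ 2) * totient f))
      (eq (mkseq (fun i => mkseq (denum_coef f a A i) d) f)).
Proof.
move=> d f0 dj a0; have ef := eta_prim R f0.
have efk k : coprime k f -> f.-primitive_root (eta R f ^+ k).
  by move=> kf; rewrite prim_root_exp_coprime.
set B := (4535 * (f * mulcost j) + 205 * (size a * j.+1 ^ 2))%N.
pose rows z (A : {poly C}) := table d f (fun m i =>
         A`_(d - m.+1) * unit_factor f a z * z ^+ (f - i.+1)).
have [A HA] : exists A : nat -> {poly C}, forall k, coprime k f ->
    eqX d (denum_series d f a (eta R f ^+ k) * A k) 1 /\
    ok (float_denum_root f a (eta R f ^+ k)) B (eq (rows (eta R f ^+ k) (A k))).
  have HA k : exists A, coprime k f ->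
      eqX d (denum_series d f a (eta R f ^+ k) * A) 1 /\
      ok (float_denum_root f a (eta R f ^+ k)) B (eq (rows (eta R f ^+ k) A)).
    case: (boolP (coprime k f)) => [kf|_]; last by exists 0.
    by have [A HA okA] := ok_float_denum_root (efk _ kf) dj; exists A.
  by have [A ?] := boolp.choice HA; exists A.
exists A => [k /HA [] //|].
set J := [seq j <- iota 1 f | coprime j f].
have K0 := prod_dvd_neq0 f a0.
pose S m i : C := \sum_(k <- J)
    (A k)`_(d - m.+1) * unit_factor f a (eta R f ^+ k) *
    (eta R f ^+ k) ^+ (f - i.+1).
eapply ok_cost.
  run_by ok_int; run_by (ok_root _ f0); run_by ok_powers.
  eapply ok_bindv.
    apply: (@ok_mapM R _ _ _ J B (fun k => rows (eta R f ^+ k) (A k))) => k.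
    rewrite mem_filter => /andP [kf _]; rewrite nth_mkseq ?ltn_mod //.
    by rewrite (prim_expr_mod ef); case: (HA k kf).
  have -> : nseq d (nseq f 0%:~R) = table d f (fun _ _ => 0 : C).
    apply: (@eq_from_nth _ [::]); rewrite size_nseq ?size_mkseq // => m ltm.
    rewrite nth_nseq ltm nth_mkseq //.
    apply: (@eq_from_nth _ 0); rewrite size_nseq ?size_mkseq // => i lti.
    by rewrite nth_nseq lti nth_mkseq.
  have -> : [seq rows (eta R f ^+ k) (A k) | k <- J] = map (table d f)
     (map (fun k m i => (A k)`_(d - m.+1) * unit_factor f a (eta R f ^+ k) *
        (eta R f ^+ k) ^+ (f - i.+1)) J) by rewrite -map_comp.
  run_by ok_sum_tables.
  have -> : table d f (fun m i => 0 + \sum_(h <- [seq (fun m i =>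
      (A k)`_(d - m.+1) * unit_factor f a (eta R f ^+ k) *
        (eta R f ^+ k) ^+ (f - i.+1)) | k <- J]) h m i) = table d f S.
    by apply: eq_mkseq => m; apply: eq_mkseq => i; rewrite big_map add0r.
  run_by ok_int.
  eapply ok_bindv.
    apply: (@ok_foldM R _ _ _ _ _ 2 (fun x (b : nat) => x * b%:R)) => x b.
    by eapply ok_cost; [run_by ok_int; apply: ok_mul|].
  set K := foldl _ _ _.
  have KE : K = \prod_(b <- a | (f %| b)%N) b%:R.
    by rewrite /K (foldl_mul (fun b => b%:R)) mul1r big_filter.
  run_by ok_invfacts.
  have -> : zip (iota 0 d)
        (zip (mkseq (fun i => (i`!%:R)^-1 : C) d) (table d f S)) =
      mkseq (fun m => (m, ((m`!%:R)^-1 : C, mkseq (S m) f))) d.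
    by rewrite /table /mkseq zip_map -[X in zip X _]map_id zip_map.
  eapply ok_bindv.
    apply: (@ok_mapM R _ _ _ _ (3 + f) (fun mr : nat * (C * seq C) =>
      mkseq (fun i => ((-1) ^+ (d + mr.1).+1 * mr.2.1 / K) * mr.2.2`_i) f)) => mr.
    move=> /mapP [m _ ->]; have Kn0 : K != 0 by rewrite KE.
    eapply ok_cost.
      run_by ok_int; run_by ok_mul; run_by (ok_div _ Kn0).
      apply: ok_le (@ok_mapM R _ _ _ _ 1 _ (fun x _ => ok_mul _ x)) (leqnn _) _.
      move=> _ <-; rewrite /mkseq -map_comp; apply/eq_in_map => i.
      rewrite mem_iota => /andP [_ lti] /=; rewrite -/(mkseq _ _) nth_mkseq //.
      by rewrite rmorphXn rmorphN1.
    by rewrite size_mkseq; lia.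
  apply: ok_ret; rewrite /mkseq; apply/eq_in_map => i.
  rewrite mem_iota => /andP [_ lti]; rewrite -!map_comp; apply: eq_map => m /=.
  rewrite -/(mkseq _ _) nth_mkseq // /denum_coef KE -/d -/J.
  by rewrite -/(mkseq (S m) f) nth_mkseq.
rewrite size_map !size_mkseq size_coprime_iota // size_filter -/d.
have := leq_exp_mulcost j; have dj' : (d <= 2 ^ j)%N by case/andP: dj.
have t0 : (0 < totient f)%N by rewrite totient_gt0.
rewrite /B; move: (mulcost j) (2 ^ j)%N dj' (size a * _)%N (totient f) t0.
move=> M N dN Y t t0 NM.
have h1 : (d * f <= f * M)%N by nia.
have h2 : (d <= f * M)%N by nia.
have h3 : (f <= f * M)%N by nia.
have h4 : (f * M <= f * M * t)%N by nia.
have h5 : (1 <= f)%N by [].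
have h6 : (t * (d * f) <= f * M * t)%N by nia.
lia.
Qed.

End FloatDenumRun.

(** * Residues and Taylor expansions at the origin *)

Section Expansion.

Local Open Scope classical_set_scope.

Variable K : numFieldType.
Implicit Types (p q : {poly K}) (h g : K -> K) (n : nat) (s : K).

Lemma derivable_horner_num p s : derivable (horner p) s 1.
Proof.
elim/poly_ind: p => [|p c IHp].
  rewrite (_ : horner 0 = cst 0); first exact: derivable_cst.
  by apply/funext => x; rewrite horner0.
rewrite (_ : horner _ = horner p * id + cst c); last first.
  by apply/funext => x; rewrite hornerMXaddC.
apply: derivableD; last exact: derivable_cst.
by apply: derivableM; [exact: IHp|exact: derivable_id].
Qed.

Lemma derivable_expr n s : derivable (fun x : K => x ^+ n) s 1.
Proof.
rewrite (_ : (fun _ => _) = horner 'X^n); first exact: derivable_horner_num.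
by apply/funext => x; rewrite hornerXn.
Qed.

Lemma derivable_continuous h s : derivable h s 1 -> {for s, continuous h}.
Proof. by move/derivable1_diffP/differentiable_continuous. Qed.

Lemma derivable1_comp h g s :
  derivable h s 1 -> derivable g (h s) 1 -> derivable (g \o h) s 1.
Proof.
move=> /derivable1_diffP dh /derivable1_diffP dg; apply/derivable1_diffP.
exact: differentiable_comp.
Qed.

(** If [h s = c + s g s] with [g] bounded near [0], then [h] tends to [c]. *)
Lemma cvg_slope h g (c B : K) :
  0 <= B -> (forall s, h s = c + s * g s) ->
  (forall s, s != 0 -> `|s| <= 1 -> `|g s| <= B) -> h s @[s --> 0^'] --> c.
Proof.
move=> B0 hg gB; rewrite -[X in _ --> X]addr0.
rewrite (_ : h = fun s => c + s * g s); last exact/funext.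
apply: cvgD; first exact: cvg_cst.
apply/cvgr0Pnorm_le => e e0.
have d0 : 0 < e / (B + 1) by rewrite divr_gt0 // ltr_wpDl.
near=> s.
have s0 : s != 0 by near: s; exact: nbhs_dnbhs_neq.
have s1 : `|s| <= 1 by near: s; apply: dnbhs0_le.
have se : `|s| <= e / (B + 1) by near: s; apply: dnbhs0_le.
rewrite normrM; apply: le_trans (_ : `|s| * B <= _).
  by rewrite ler_wpM2l // gB.
apply: le_trans (ler_wpM2r B0 se) _.
rewrite mulrAC ler_pdivrMr ?ltr_wpDl //.
by rewrite ler_wpM2l ?(ltW e0) ?lerDl.
Unshelve. all: by end_near.
Qed.

(** If [h s = c + s g s] and [g] tends to [l] at [0], then [h] has a derivative at
    [0]; this derivative is [l]. *)
Lemma derivable_slope h g (c l : K) :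
  (forall s, h s = c + s * g s) -> g s @[s --> 0^'] --> l -> derivable h 0 1.
Proof.
move=> hg gl; apply/cvg_ex; exists l; apply: (cvg_trans _ gl).
apply: near_eq_cvg; near=> s.
have s0 : s != 0 by near: s; exact: nbhs_dnbhs_neq.
rewrite /= addr0 [s%:A]mulr1 !hg mul0r addr0.
by rewrite addrC addKr /GRing.scale /= mulKf.
Unshelve. all: by end_near.
Qed.

Lemma continuous_eq0 h :
  {for 0, continuous h} -> (\forall s \near (0 : K)^', h s = 0) -> h 0 = 0.
Proof.
move=> /continuous_withinNx h0 hz.
apply: (@cvg_unique _ (@norm_hausdorff _ K) (h @ 0^')) => //.
exact: cvg_near_cst.
Qed.

(** A polar part that cancels a function differentiable at [0] is zero. *)
Lemma polar_part_eq0 (c : nat -> K) n h :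
  derivable h 0 1 ->
  (\forall s \near (0 : K)^', \sum_(k < n) c k / s ^+ k.+1 + h s = 0) ->
  forall k, (k < n)%N -> c k = 0.
Proof.
move=> dh; elim: n => // n IHn Hc.
have cn : c n = 0.
  (* Multiplied by s ^ (n + 1), the relation becomes H = 0 away from 0, for a
     continuous function H with H(0) = c_n. *)
  pose P : {poly K} := \sum_(k < n.+1) c k *: 'X^(n - k).
  pose H := horner P + (fun s => s ^+ n.+1) * h.
  have H0 : H 0 = 0.
    apply: continuous_eq0.
      apply: derivable_continuous; apply: derivableD.
        exact: derivable_horner_num.
      by apply: derivableM; [exact: derivable_expr|exact: dh].
    near=> s; have s0 : s != 0 by near: s; exact: nbhs_dnbhs_neq.
    rewrite /H /= -[RHS](mulr0 (s ^+ n.+1)).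
    rewrite -(_ : \sum_(k < n.+1) c k / s ^+ k.+1 + h s = 0); last by near: s.
    rewrite mulrDr mulr_sumr /P [LHS]/=; congr (_ + _).
    rewrite horner_sum; apply: eq_bigr => -[k /= ltk] _.
    rewrite hornerZ hornerXn mulrCA; congr (_ * _).
    by rewrite -[n.+1](@subnK k.+1) // exprD mulfK ?expf_neq0 // subSS.
  move: H0; rewrite /H /= -[X in X -> _]/(P.[0] + 0 ^+ n.+1 * h 0 = 0).
  rewrite expr0n mul0r addr0 horner_sum big_ord_recr /= subnn.
  rewrite hornerZ hornerXn expr0 mulr1 big1 ?add0r // => -[k /= ltk] _.
  by rewrite hornerZ hornerXn expr0n subn_eq0 leqNgt ltk mulr0.
have IH : forall k, (k < n)%N -> c k = 0.
  apply: IHn; near=> s.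
  rewrite -[RHS](_ : \sum_(k < n.+1) c k / s ^+ k.+1 + h s = 0); last by near: s.
  by rewrite big_ord_recr /= cn mul0r addr0.
by move=> k; rewrite ltnS leq_eqVlt => /predU1P [-> //|/IH].
Unshelve. all: by end_near.
Qed.

Lemma residue0_unique (F : K -> K) r1 r2 :
  is_residue0 F r1 -> is_residue0 F r2 -> r1 = r2.
Proof.
move=> [c1 [G1 [dG1 F1 ->]]] [c2 [G2 [dG2 F2 ->]]].
pose n := (maxn (size c1) (size c2)).+1.
have widen (c : seq K) s : (size c <= n)%N ->
    \sum_(k < size c) c`_k / s ^+ k.+1 = \sum_(k < n) c`_k / s ^+ k.+1.
  move=> lecn; rewrite (big_ord_widen n (fun k => c`_k / s ^+ k.+1)) //.
  rewrite big_mkcond; apply: eq_bigr => k _; case: ltnP => // leck.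
  by rewrite nth_default // mul0r.
apply/eqP; rewrite -subr_eq0; apply/eqP.
apply: (@polar_part_eq0 (fun k => c1`_k - c2`_k) n (G1 - G2)) => //.
  apply: derivableB; first exact: (nbhs_singleton dG1).
  exact: (nbhs_singleton dG2).
near=> s.
have E1 : F s = \sum_(k < size c1) c1`_k / s ^+ k.+1 + G1 s by near: s.
have E2 : F s = \sum_(k < size c2) c2`_k / s ^+ k.+1 + G2 s by near: s.
under eq_bigr do rewrite mulrBl.
rewrite big_split /= sumrN -!widen; try by rewrite /n; lia.
rewrite -[(G1 - G2) s]/(G1 s - G2 s) addrACA -opprD -E1 -E2 subrr //.
Unshelve. all: by end_near.
Qed.

Lemma residue0E (F : K -> K) r : is_residue0 F r -> residue0 F = r.
Proof.
by move=> Fr; apply: xget_unique => // r' /residue0_unique; apply.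
Qed.

(** Holomorphy near [0]. *)
Definition holo0 h : Prop := \forall s \near (0 : K), derivable h s 1.

Lemma holo0_horner p : holo0 (horner p).
Proof. by apply: filterE => s; apply: derivable_horner_num. Qed.

Lemma holo0_expr n : holo0 (fun s => s ^+ n).
Proof. by apply: filterE => s; apply: derivable_expr. Qed.

Lemma holo0_cst c : holo0 (cst c).
Proof. by apply: filterE => s; apply: derivable_cst. Qed.

Lemma holo0N h : holo0 h -> holo0 (- h).
Proof. by apply: filterS => s; apply: derivableN. Qed.

Lemma holo0D h g : holo0 h -> holo0 g -> holo0 (h + g).
Proof. by apply: filterS2 => s; apply: derivableD. Qed.

Lemma holo0M h g : holo0 h -> holo0 g -> holo0 (h * g).
Proof. by apply: filterS2 => s; apply: derivableM. Qed.

Lemma holo0_neq0 h : holo0 h -> h 0 != 0 -> \forall s \near (0 : K), h s != 0.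
Proof.
move=> dh h0; have ch := derivable_continuous (nbhs_singleton dh).
exact: cvgr_neq0 ch h0.
Qed.

Lemma holo0V h : holo0 h -> h 0 != 0 -> holo0 (fun s => (h s)^-1).
Proof.
move=> dh h0; apply: filterS2 (holo0_neq0 dh h0) dh => s.
exact: derivableV.
Qed.

(** The function [h] is [p] plus [s ^ n] times a function holomorphic near [0];
    the degree of [p] is not bounded, so that only its coefficients below [n]
    are determined by [h]. *)
Definition expands n h p := exists r : K -> K,
  holo0 r /\ (\forall s \near (0 : K), h s = p.[s] + s ^+ n * r s).

Lemma expands_poly n p : expands n (horner p) p.
Proof.
exists (cst 0); split; first exact: holo0_cst.
by near=> s; rewrite mulr0 addr0.
Unshelve. all: by end_near.
Qed.

Lemma expands_near n h g p :
  (\forall s \near (0 : K), h s = g s) -> expands n h p -> expands n g p.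
Proof.
move=> hg [r [dr hE]]; exists r; split=> //; near=> s.
by rewrite -(_ : h s = g s); near: s.
Unshelve. all: by end_near.
Qed.

Lemma eqX_horner n p q s :
  eqX n p q -> p.[s] = q.[s] + s ^+ n * (drop_poly n (p - q)).[s].
Proof.
move=> pq; set D := drop_poly n (p - q).
have -> : p = q + 'X^n * D by
  rewrite -[LHS](subrK q) addrC -[in LHS](poly_take_drop n (p - q));
  rewrite [take_poly _ _](_ : _ = 0) ?add0r 1?[_ * 'X^n]mulrC //;
  apply/polyP => i; rewrite coef_take_poly coef0; case: ifP => // lti;
  rewrite coefB pq // subrr.
by rewrite hornerD hornerM hornerXn.
Qed.

Lemma expands_eqX n h p q : eqX n p q -> expands n h p -> expands n h q.
Proof.
move=> pq [r [dr hE]]; exists (r + horner (drop_poly n (p - q))); split.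
  exact: holo0D dr (holo0_horner _).
near=> s; have -> : h s = p.[s] + s ^+ n * r s by near: s.
rewrite (eqX_horner s pq) -[(r + _) s]/(r s + (drop_poly n (p - q)).[s]).
by rewrite mulrDr [s ^+ n * r s + _]addrC addrA.
Unshelve. all: by end_near.
Qed.

Lemma expandsD n h g p q :
  expands n h p -> expands n g q -> expands n (fun s => h s + g s) (p + q).
Proof.
move=> [r1 [dr1 hE]] [r2 [dr2 gE]]; exists (r1 + r2); split.
  exact: holo0D.
near=> s; have -> : h s = p.[s] + s ^+ n * r1 s by near: s.
have -> : g s = q.[s] + s ^+ n * r2 s by near: s.
by rewrite hornerD -[(r1 + r2) s]/(r1 s + r2 s); ring.
Unshelve. all: by end_near.
Qed.

Lemma expandsM n h g p q :
  expands n h p -> expands n g q -> expands n (fun s => h s * g s) (p * q).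
Proof.
move=> [r1 [dr1 hE]] [r2 [dr2 gE]].
exists (horner p * r2 + horner q * r1 + (fun s => s ^+ n) * (r1 * r2)); split.
  apply: holo0D; last exact: holo0M (holo0_expr n) (holo0M dr1 dr2).
  exact: holo0D (holo0M (holo0_horner p) dr2) (holo0M (holo0_horner q) dr1).
near=> s; have -> : h s = p.[s] + s ^+ n * r1 s by near: s.
have -> : g s = q.[s] + s ^+ n * r2 s by near: s.
rewrite hornerM /= -[X in _ = _ + _ * X]/(p.[s] * r2 s + q.[s] * r1 s +
  s ^+ n * (r1 s * r2 s)).
ring.
Unshelve. all: by end_near.
Qed.

Lemma expandsZ n c h p : expands n h p -> expands n (fun s => c * h s) (c *: p).
Proof.
move=> hp; rewrite -mul_polyC; apply: expandsM => //.
apply: expands_near (expands_poly n c%:P).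
by near=> s; rewrite hornerC.
Unshelve. all: by end_near.
Qed.

Lemma expands_sum (I : eqType) (t : seq I) n (h : I -> K -> K)
    (p : I -> {poly K}) :
  (forall i, i \in t -> expands n (h i) (p i)) ->
  expands n (fun s => \sum_(i <- t) h i s) (\sum_(i <- t) p i).
Proof.
elim: t => [|i t IHt] ht.
  rewrite big_nil; apply: expands_near (expands_poly n 0).
  by near=> s; rewrite big_nil horner0.
rewrite big_cons; apply: (@expands_near _ (fun s => h i s + \sum_(i <- t) h i s)).
  by near=> s; rewrite big_cons.
apply: expandsD; first by apply: ht; rewrite mem_head.
by apply: IHt => k kt; apply: ht; rewrite inE kt orbT.
Unshelve. all: by end_near.
Qed.

Lemma expands_prod (I : Type) (t : seq I) n (h : I -> K -> K)
    (p : I -> {poly K}) :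
  (forall i, expands n (h i) (p i)) ->
  expands n (fun s => \prod_(i <- t) h i s) (\prod_(i <- t) p i).
Proof.
move=> ht; elim: t => [|i t IHt].
  rewrite big_nil; apply: expands_near (expands_poly n 1).
  by near=> s; rewrite big_nil hornerC.
rewrite big_cons.
apply: (@expands_near _ (fun s => h i s * \prod_(i <- t) h i s)).
  by near=> s; rewrite big_cons.
exact: expandsM.
Unshelve. all: by end_near.
Qed.

(** The function inverse to [h] has the power series inverse to that of [h]. *)
Lemma expandsV n h p q : (0 < n)%N -> eqX n (p * q) 1 -> expands n h p ->
  expands n (fun s => (h s)^-1) q.
Proof.
move=> n0 pq [r [dr hE]].
pose h' := horner p + (fun s => s ^+ n) * r.
pose w := drop_poly n (p * q - 1).
have dh' : holo0 h'.
  exact: holo0D (holo0_horner _) (holo0M (holo0_expr n) dr).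
have h'0 : h' 0 != 0.
  apply/eqP; rewrite -[h' 0]/(p.[0] + 0 ^+ n * r 0) expr0n gtn_eqF // mul0r addr0.
  rewrite horner_coef0 => p0; have := pq 0%N n0.
  by rewrite coef0M p0 mul0r coef1 => /esym/eqP; rewrite oner_eq0.
have nh' := holo0_neq0 dh' h'0.
exists (- ((horner w + horner q * r) * (fun s => (h' s)^-1))); split.
  apply/holo0N/holo0M; last exact: holo0V.
  exact: holo0D (holo0_horner _) (holo0M (holo0_horner _) dr).
near=> s.
have -> : h s = h' s by near: s; exact: hE.
have h's : h' s != 0 by near: s.
have E : q.[s] * h' s = 1 + s ^+ n * (w.[s] + q.[s] * r s).
  have := eqX_horner s pq; rewrite hornerM hornerC -/w => E.
  rewrite -[h' s]/(p.[s] + s ^+ n * r s) mulrDr [q.[s] * p.[s]]mulrC E; ring.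
rewrite -[X in _ = _ + _ * X]/(- ((w.[s] + q.[s] * r s) / h' s)).
rewrite mulrN mulrA.
have -> : s ^+ n * (w.[s] + q.[s] * r s) = q.[s] * h' s - 1 by rewrite E; ring.
by field.
Unshelve. all: by end_near.
Qed.

(** If [h] expands to [p] modulo [s ^ n], the residue at [0] of [h s / s ^ n] is
    the coefficient of degree [n - 1] of [p]. *)
Lemma is_residue0_expands n (F : K -> K) h p :
  (0 < n)%N -> (\forall s \near (0 : K)^', F s = h s / s ^+ n) ->
  expands n h p -> is_residue0 F p`_n.-1.
Proof.
move=> n0 Fh /(@expands_eqX _ _ _ (take_poly n p)) [|r [dr hE]].
  by move=> i lti; rewrite coef_take_poly lti.
exists (mkseq (fun k => p`_(n - k.+1)) n), r; split=> //; last first.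
  by rewrite nth_mkseq // subn1.
near=> s; have s0 : s != 0 by near: s; exact: nbhs_dnbhs_neq.
have -> : F s = h s / s ^+ n by near: s.
have -> : h s = (take_poly n p).[s] + s ^+ n * r s.
  by near: s; apply: nbhs_dnbhs; exact: hE.
rewrite mulrDl [s ^+ n * _]mulrC mulfK ?expf_neq0 // size_mkseq; congr (_ + _).
rewrite (horner_coef_wide _ (size_take_poly _ _)) mulr_suml.
rewrite (reindex_inj rev_ord_inj) /=.
apply: eq_bigr => -[k /= ltk] _; rewrite nth_mkseq // coef_take_poly.
have -> : (n - k.+1 < n)%N by lia.
rewrite -mulrA; congr (_ * _).
rewrite -[in X in _ / X](@subnK k.+1 n) // exprD invfM mulrA.
by rewrite divff ?mul1r // expf_neq0.
Unshelve. all: by end_near.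
Qed.

End Expansion.

(** * Taylor expansion of the complex exponential *)

Section CexpTaylor.

Local Open Scope classical_set_scope.
Local Open Scope complex_scope.

Variable R : realType.
Local Notation C := (complex R).
Implicit Types (w s : C) (m n : nat) (x : R).

Lemma Re_add w s : complex.Re (w + s) = complex.Re w + complex.Re s.
Proof. by case: w; case: s. Qed.

Lemma Re_opp w : complex.Re (- w) = - complex.Re w.
Proof. by case: w. Qed.

Lemma Re_sum n (F : nat -> C) :
  complex.Re (\sum_(k < n) F k) = \sum_(k < n) complex.Re (F k).
Proof.
elim: n => [|n IHn]; first by rewrite !big_ord0.
by rewrite !big_ord_recr /= Re_add IHn.
Qed.

(** The remainder of the exponential series after [m] terms. *)
Definition exp_rem m s : C := cexp s - (exp_series R m).[s].

(** A real-valued norm on the complex numbers, equivalent to the modulus. *)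
Definition norm1 s : R := `|complex.Re s| + `|complex.Im s|.

Lemma norm1M w s : norm1 (w * s) <= norm1 w * norm1 s.
Proof.
case: w => a b; case: s => x y; rewrite /norm1 /=.
have := ler_normB (a * x) (b * y); have := ler_normD (a * y) (b * x).
rewrite !normrM; lra.
Qed.

Lemma norm1_ge0 s : 0 <= norm1 s.
Proof. by rewrite /norm1 addr_ge0. Qed.

(** The real part of [w] times the remainder, along the segment from [0] to [s]:
    a real function of a real variable, to which the mean value theorem
    applies.  The factor [w] makes the family stable under differentiation. *)
Definition ray w s m x : R :=
  expR (x * complex.Re s) *
    (complex.Re w * cos (x * complex.Im s) -
     complex.Im w * sin (x * complex.Im s))
  - (\poly_(k < m) complex.Re (w * s ^+ k / k`!%:R)).[x].

Lemma Re_mulr_real w x : complex.Re (w * x%:C) = complex.Re w * x.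
Proof. by case: w => a b /=; rewrite mulr0 subr0. Qed.

Lemma rayE w s m x : ray w s m x = complex.Re (w * exp_rem m (x%:C * s)).
Proof.
have -> : w * exp_rem m (x%:C * s) = w * cexp (x%:C * s) +
    - \sum_(k < m) w * s ^+ k / k`!%:R * (x ^+ k)%:C.
  rewrite mulrBr horner_poly mulr_sumr; congr (_ - _); apply: eq_bigr => k _.
  by rewrite exprMn rmorphXn /=; ring.
rewrite Re_add Re_opp (Re_sum m (fun k => w * s ^+ k / k`!%:R * (x ^+ k)%:C)).
rewrite /ray horner_poly; congr (_ - _); last first.
  by apply: eq_bigr => k _; rewrite Re_mulr_real.
have -> : x%:C * s = (x * complex.Re s) +i* (x * complex.Im s).
  by case: s => u v; apply/eqP; rewrite eq_complex /= !mul0r subr0 addr0 !eqxx.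
case: w => a b; rewrite /cexp /=; ring.
Qed.

Lemma is_derive_ray w s m x :
  is_derive x (1 : R) (ray w s m.+1) (ray (w * s) s m x).
Proof.
rewrite /ray; set p := \poly_(k < m.+1) _; set q := \poly_(k < m) _.
have -> : q = deriv p.
  apply/polyP => k; rewrite coef_deriv !coef_poly ltnS.
  case: ifP => _; last by rewrite mul0rn.
  have -> : w * s ^+ k.+1 / k.+1`!%:R =
      w * s * s ^+ k / k`!%:R * (k.+1%:R^-1 : R)%:C.
    rewrite factS natrM fmorphV rmorph_nat exprS; field.
    by rewrite !pnatr_eq0 -lt0n fact_gt0 /= addrC natr1 pnatr_eq0.
  by rewrite Re_mulr_real -[RHS]mulr_natr divfK // pnatr_eq0.
apply: is_derive_eq.
rewrite !scaler0 !add0r ![_%:A]mulr1; congr (_ - _).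
case: w {p q} => a b; case: s => u v /=.
rewrite /GRing.scale /=.
ring.
Qed.

Lemma ray_le w s m x : 0 <= x <= 1 ->
  `|ray w s m x| <= norm1 w * norm1 s ^+ m * expR (norm1 s).
Proof.
elim: m w x => [|m IHm] w x /andP [x0 x1].
  rewrite /ray horner_poly big_ord0 subr0 normrM mulrC expr0 mulr1.
  rewrite ler_pM ?normr_ge0 //.
    apply: le_trans (ler_normB _ _) _; rewrite !normrM /norm1.
    by apply: lerD; rewrite ler_piMr // ?cos_max ?sin_max.
  rewrite ger0_norm ?expR_ge0 // ler_expR; apply: le_trans (ler_norm _) _.
  rewrite normrM ger0_norm // /norm1.
  have := normr_ge0 (complex.Re s); have := normr_ge0 (complex.Im s).
  by nra.
have ray0 : ray w s m.+1 0 = 0.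
  rewrite /ray !mul0r expR0 cos0 sin0 horner_coef0 coef_poly /= expr0 divr1.
  by rewrite !mulr1 mulr0 subr0 mul1r subrr.
have [||c cx] := @MVT_segment R (ray w s m.+1) (ray (w * s) s m) 0 x x0.
- by move=> y _; apply: is_derive_ray.
- apply: derivable_within_continuous => y _.
  by have /@ex_derive := is_derive_ray w s m y.
rewrite ray0 !subr0 => ->; move: cx; rewrite in_itv /= => /andP [c0 cx].
rewrite normrM (ger0_norm x0).
apply: le_trans (_ : `|ray (w * s) s m c| * 1 <= _); first by rewrite ler_wpM2l.
rewrite mulr1; apply: le_trans (IHm _ _ _) _; first by rewrite c0 (le_trans cx).
rewrite ler_wpM2r ?expR_ge0 // exprS mulrA ler_wpM2r ?exprn_ge0 ?norm1_ge0 //.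
exact: norm1M.
Qed.

Lemma norm_norm1 s : exists2 r : R, `|s| = r%:C & r <= norm1 s <= 2 * r.
Proof.
exists (Num.sqrt (complex.Re s ^+ 2 + complex.Im s ^+ 2)); first exact: normc_def.
case: s => a b; rewrite /norm1 /=; apply/andP; split.
  rewrite -[leRHS]ger0_norm ?addr_ge0 // -sqrtr_sqr ler_sqrt ?sqr_ge0 //.
  rewrite sqrrD !real_normK ?num_real // lerD2r lerDl.
  by rewrite mulrn_wge0 // mulr_ge0.
rewrite mulr2n mulrDl mul1r -!sqrtr_sqr.
by apply: lerD; apply: ler_wsqrtr; rewrite ?lerDl ?lerDr sqr_ge0.
Qed.

(** The remainder after [m] terms is [O(s ^ m)]. *)
Lemma exp_rem_le m : exists B : C, forall s : C, `|s| <= 1 ->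
  `|exp_rem m s| <= B * `|s| ^+ m.
Proof.
exists (2 * 2 ^+ m * expR 2)%:C => s s1.
have [r sr /andP [_ sr2]] := norm_norm1 s.
have [t Et /andP [tE _]] := norm_norm1 (exp_rem m s).
have r1 : r <= 1 by rewrite sr -[1]/(1%:C) lecR in s1.
rewrite Et sr -(rmorphXn (real_complex R)) -(rmorphM (real_complex R)) lecR.
apply: le_trans tE _.
have bound w : norm1 w = 1 ->
    `|complex.Re (w * exp_rem m s)| <= (2 * r) ^+ m * expR 2.
  move=> w1; have := @ray_le w s m 1; rewrite rayE mul1r ler01 lexx => /(_ isT).
  move=> /le_trans; apply; rewrite w1 mul1r.
  apply: ler_pM; rewrite ?expR_ge0 ?exprn_ge0 ?norm1_ge0 //.
    by rewrite lerXn2r ?nnegrE ?norm1_ge0 // (le_trans (norm1_ge0 s)).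
  by rewrite ler_expR (le_trans sr2) //; lra.
(* For w = -i, the real part of w E is the imaginary part of E. *)
have bR := bound 1; have bI := bound (0 +i* (-1)).
move: bR bI; case: (exp_rem m s) => a b.
rewrite /norm1 /= !mul1r !mul0r normr1 normr0 normrN1 addr0 add0r subr0 sub0r.
rewrite mulN1r opprK.
move=> /(_ erefl) ha /(_ erefl) hb.
by apply: le_trans (lerD ha hb) _; rewrite exprMn; lra.
Qed.

(** The quotient by [s ^ m] of the remainder after [m] terms of the exponential
    series, completed by continuity at [0]. *)
Definition exp_quo m s : C :=
  if s == 0 then (m`!%:R)^-1 else exp_rem m s / s ^+ m.

Lemma exp_remS m s : exp_rem m s = s ^+ m / m`!%:R + exp_rem m.+1 s.
Proof.
by rewrite /exp_rem !horner_poly big_ord_recr /= [_^-1 * _]mulrC; ring.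
Qed.

Lemma exp_quoS m s : exp_quo m s = (m`!%:R)^-1 + s * exp_quo m.+1 s.
Proof.
rewrite /exp_quo; have [->|s0] := eqVneq s 0; first by rewrite mul0r addr0.
rewrite exp_remS exprS; field.
by rewrite expf_neq0 s0 ?pnatr_eq0 -?lt0n ?fact_gt0.
Qed.

Lemma exp_quoE m s : cexp s = (exp_series R m).[s] + s ^+ m * exp_quo m s.
Proof.
rewrite /exp_quo; have [->|s0] := eqVneq s 0; last first.
  by rewrite mulrCA divff ?expf_neq0 // mulr1 /exp_rem; ring.
rewrite cexp0 horner_coef0 coef_poly; case: m => [|m] /=.
  by rewrite add0r mul1r fact0 invr1.
by rewrite exprS !mul0r addr0 invr1.
Qed.

(* The complex numbers with the topology of a numeric field. *)
Local Notation K := (complex R : numFieldType).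

Lemma exp_quo_cvg m : (exp_quo m : K -> K) @ (0 : K)^' --> (m`!%:R^-1 : K).
Proof.
have [B HB] := exp_rem_le m.+1.
have B0 : 0 <= B.
  have := HB 1; rewrite normr1 lexx expr1n mulr1 => /(_ isT).
  exact: le_trans.
apply: (@cvg_slope K _ (exp_quo m.+1) _ B B0) => [s|s s0 s1]; first exact: exp_quoS.
rewrite /exp_quo (negPf s0) normrM normfV normrX.
by rewrite ler_pdivrMr ?exprn_gt0 ?normr_gt0 // HB.
Qed.

Lemma derivable_exp_quo0 m : derivable (exp_quo m : K -> K) (0 : K) 1.
Proof. by apply: (@derivable_slope K _ _ _ _ (exp_quoS m)); apply: exp_quo_cvg. Qed.

Lemma derivable_cexp (s : K) : derivable (@cexp R : K -> K) s 1.
Proof.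
have c0 : derivable (@cexp R : K -> K) (0 : K) 1.
  rewrite (_ : @cexp R = exp_quo 0); first exact: derivable_exp_quo0.
  by apply/funext => z; rewrite (exp_quoE 0) horner_poly big_ord0 add0r mul1r.
have -> : @cexp R = (cst (cexp s)) * (@cexp R \o (fun z => z - s)).
  by apply/funext => z; rewrite -[RHS]/(cexp s * cexp (z - s)) -cexpD addrC subrK.
apply: derivableM; first exact: derivable_cst.
apply: derivable1_comp; last by rewrite subrr.
by apply: derivableB; [exact: derivable_id|exact: derivable_cst].
Qed.

Lemma derivable_exp_quo m (s : K) : derivable (exp_quo m : K -> K) s 1.
Proof.
have [->|s0] := eqVneq s 0; first exact: derivable_exp_quo0.
apply: (@near_eq_derivable _ _ _
  (((@cexp R : K -> K) - (horner (exp_series R m) : K -> K)) *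
     (fun z : K => (z ^+ m)^-1) : K -> K)).
  near=> z.
  have z0 : z != 0 by near: z; apply: (cvgr_neq0 s) => //; exact: cvg_id.
  by rewrite /exp_quo (negPf z0).
apply: derivableM.
  by apply: derivableB; [exact: derivable_cexp|exact: derivable_horner_num].
by apply: derivableV; [rewrite expf_neq0|exact: derivable_expr].
Unshelve. all: by end_near.
Qed.

Lemma expands_cexp n (c : K) :
  expands n (fun s : K => cexp (c * s)) (exp_series R n \Po (c *: 'X)).
Proof.
exists (cst (c ^+ n) * (exp_quo n \o (fun s => c * s))); split.
  apply: holo0M; first exact: holo0_cst.
  apply: filterE => s; apply: derivable1_comp; last exact: derivable_exp_quo.
  by apply: derivableM; [exact: derivable_cst|exact: derivable_id].
apply: filterE => s; rewrite (exp_quoE n) horner_comp hornerZ hornerX.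
congr (_ + _).
by rewrite -[RHS]/(s ^+ n * (c ^+ n * exp_quo n (c * s))) exprMn mulrCA mulrA.
Qed.

End CexpTaylor.

(** * The Sylvester wave *)

Section Residue.

Local Open Scope classical_set_scope.
Local Open Scope complex_scope.

Variable R : realType.
Local Notation C := (complex R).
(* The complex numbers with the topology of a numeric field. *)
Local Notation K := (complex R : numFieldType).

(** A factor that does not vanish at [0]. *)
Lemma expands_regular_factor n (w : K) b :
  1 - w != 0 ->
  expands n (fun s : K => 1 - w * cexp (b%:R * s))
    ((1 - w) *: (gy_inv n (w / (1 - w)) \Po (b%:R *: 'X))).
Proof.
move=> w1.
have -> : (1 - w) *: (gy_inv n (w / (1 - w)) \Po (b%:R *: 'X)) =
    1 + - w *: (exp_series R n \Po (b%:R *: 'X)).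
  rewrite /gy_inv comp_polyB comp_polyZ comp_polyB -[1 : {poly C}]/(1%:P).
  rewrite comp_polyC scalerBr scalerA [(1 - w) * _]mulrC divfK //.
  rewrite -!mul_polyC polyCB polyCN.
  ring.
apply: (@expands_near K _ (fun s => 1 + - w * cexp (b%:R * s))).
  by apply: filterE => s; rewrite mulNr.
apply: expandsD; last by apply: expandsZ; apply: expands_cexp.
apply: expands_near (@expands_poly K n 1).
by apply: filterE => s; rewrite hornerC.
Qed.

(** A factor that vanishes at [0], with its zero split off. *)
Lemma expands_pole_factor n b : exists2 h : K -> K,
  expands n h (- b%:R *: (g_inv R n \Po (b%:R *: 'X))) &
  \forall s \near (0 : K), 1 - cexp (b%:R * s) = s * h s.
Proof.
set p : {poly K} := - b%:R *: _.
have [r [dr rE]] := @expands_cexp R n.+1 b%:R.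
exists (horner p + (fun s => s ^+ n) * (- r)).
  exists (- r); split; first exact: holo0N.
  by apply: filterE.
apply: filterS rE => s ->.
rewrite -[X in _ = s * X]/(p.[s] + s ^+ n * (- r s)).
have -> : exp_series R n.+1 \Po (b%:R *: 'X) = 1 - 'X * p.
  apply/polyP => i; rewrite coef_scaleX coef_poly coefB coef1 coefXM.
  case: i => [|i] /=; first by rewrite fact0 invr1 expr0 mul1r subr0.
  rewrite sub0r coefZ coef_scaleX coef_poly ltnS.
  case: ifP => _; last by rewrite !mulr0 oppr0.
  by rewrite exprS mulNr opprK mulrA.
rewrite hornerD hornerN hornerM hornerX hornerC exprS; ring.
Qed.

Lemma near_eq_prod (I : Type) (t : seq I) (u v : I -> K -> K) :
  (forall i, \forall s \near (0 : K), u i s = v i s) ->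
  \forall s \near (0 : K), \prod_(i <- t) u i s = \prod_(i <- t) v i s.
Proof.
move=> uv; elim: t => [|i t IHt].
  by apply: filterE => s; rewrite !big_nil.
by apply: filterS2 (uv i) IHt => s ui IH; rewrite !big_cons ui IH.
Qed.

(** The term of the wave attached to the primitive root [z] is [h s / s ^ d] near
    [0], where [h] expands to the product of the series of [z ^ (- t) e ^ (- t s)]
    and of a multiple of an inverse [A] of [denum_series] modulo [s ^ d]. *)
Lemma expands_wave_term (f : nat) (a : seq nat) (z : K) (t : int) (A : {poly K}) :
  let d := count (dvdn f) a in
  f.-primitive_root z -> (0 < d)%N -> all (fun b => 0 < b)%N a ->
  eqX d (denum_series d f a z * A) 1 ->
  exists2 h : K -> K,
    expands d h ((z ^ (- t) *: (exp_series R d \Po (- t%:~R *: 'X))) *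
      (((-1) ^+ d / (\prod_(b <- a | (f %| b)%N) b%:R) *
        unit_factor f a z) *: A)) &
    \forall s \near (0 : K), z ^ (- t) * cexp (- (t%:~R * s))
        / \prod_(b <- a) (1 - z ^+ b * cexp (b%:R * s)) = h s / s ^+ d.
Proof.
move=> d zf d0 a0 HA.
pose pi b : {poly K} := if (f %| b)%N then - b%:R *: (g_inv R d \Po (b%:R *: 'X))
  else (1 - z ^+ b) *: (gy_inv d (z ^+ b / (1 - z ^+ b)) \Po (b%:R *: 'X)).
have Hphi b : exists h : K -> K, expands d h (pi b) /\
    \forall s \near (0 : K),
      1 - z ^+ b * cexp (b%:R * s) = (if (f %| b)%N then s else 1) * h s.
  rewrite /pi; case: ifPn => [fb|fb].
    have [h hp hE] := expands_pole_factor d b; exists h; split=> //.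
    apply: filterS hE => s <-; rewrite (_ : z ^+ b = 1) ?mul1r //.
    by apply/eqP; rewrite -(prim_order_dvd zf).
  exists (fun s : K => 1 - z ^+ b * cexp (b%:R * s)); split.
    exact: expands_regular_factor (prim_root_neq1 zf fb).
  by apply: filterE => s; rewrite mul1r.
have [phi phiP] := boolp.choice Hphi.
(* The sign and the product of the b come from the factors vanishing at 0. *)
have prodpi : \prod_(b <- a) pi b =
    ((-1) ^+ d * (\prod_(b <- a | (f %| b)%N) b%:R) *
     \prod_(b <- a | ~~ (f %| b)%N) (1 - z ^+ b)) *: denum_series d f a z.
  rewrite {1}/d /denum_series; elim: (a) => [|b l IHl].
    by rewrite !big_nil expr0 !mulr1 scale1r.
  rewrite !big_cons IHl /= {1}/pi; case: ifP => fb /=.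
    rewrite exprS -scalerAl -scalerAr scalerA -!mul_polyC !polyCM; ring.
  rewrite add0n -scalerAl -scalerAr scalerA -!mul_polyC !polyCM; ring.
have K0 := prod_dvd_neq0 R f a0.
have U0 : \prod_(b <- a | ~~ (f %| b)%N) (1 - z ^+ b) != 0.
  rewrite prodf_seq_neq0; apply/allP => b ba; apply/implyP.
  exact: prim_root_neq1.
exists (fun s => z ^ (- t) * cexp (- t%:~R * s) * (\prod_(b <- a) phi b s)^-1).
  apply: expandsM; first by apply: expandsZ; apply: expands_cexp.
  apply: (@expandsV _ _ _ (\prod_(b <- a) pi b)) => //; last first.
    by apply: expands_prod => b; case: (phiP b).
  rewrite prodpi -scalerAl -scalerAr scalerA /unit_factor prodfV.
  set c := _ * _; suff -> : c = 1 by rewrite scale1r.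
  transitivity ((-1 : C) ^+ d * (-1) ^+ d); last by rewrite -expr2 sqrr_sign.
  by rewrite /c; field; rewrite U0 K0.
have := @near_eq_prod _ a _ _ (fun b => proj2 (phiP b)).
apply: filterS => s ->; rewrite big_split /= -mulNr.
rewrite -big_mkcond /= big_const_seq -/d.
have -> : iter d ( *%R s) 1 = s ^+ d by elim: (d) => //= n ->; rewrite exprS.
by rewrite invfM [s ^- d * _]mulrC mulrA.
Qed.

(** The residue of a term; it is a polynomial in [t], apart from [z ^ (- t)]. *)
Lemma coef_wave_term d (z : C) (t : int) (c : C) (A : {poly C}) :
  (0 < d)%N ->
  ((z ^ (- t) *: (exp_series R d \Po (- t%:~R *: 'X))) * (c *: A))`_d.-1 =
  \sum_(m < d) (-1) ^+ m / m`!%:R * t%:~R ^+ m * (c * A`_(d - m.+1) * z ^ (- t)).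
Proof.
move=> d0; rewrite coefM (prednK d0); apply: eq_bigr => -[m /= ltm] _.
rewrite !coefZ coef_scaleX coef_poly ltm (exprNn t%:~R).
have -> : (d.-1 - m = d - m.+1)%N by lia.
ring.
Qed.

(** The wave as the sum of the residues over the primitive roots, which are the
    powers of [eta_f] with exponent coprime to [f]. *)
Lemma wave_residue (f : nat) (a : seq nat) (t : int) (A : nat -> {poly C}) :
  let d := count (dvdn f) a in
  let J := [seq j <- iota 1 f | coprime j f] in
  (0 < f)%N -> (0 < d)%N -> all (fun b => 0 < b)%N a ->
  (forall k, coprime k f -> eqX d (denum_series d f a (eta R f ^+ k) * A k) 1) ->
  sylvester_wave R f a t =
  - \sum_(j <- J) \sum_(m < d) (-1) ^+ m / m`!%:R * t%:~R ^+ m *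
      ((-1) ^+ d / (\prod_(b <- a | (f %| b)%N) b%:R) *
       unit_factor f a (eta R f ^+ j) * (A j)`_(d - m.+1) *
       (eta R f ^+ j) ^ (- t)).
Proof.
move=> d J f0 d0 a0 HA; rewrite /sylvester_wave; congr (- _).
have ef := eta_prim R f0.
have prim k : coprime k f -> f.-primitive_root (eta R f ^+ k).
  by move=> kf; rewrite prim_root_exp_coprime.
have JP k : k \in J -> coprime k f by rewrite mem_filter => /andP [].
have uJ : uniq [seq eta R f ^+ k | k <- J].
  rewrite map_inj_in_uniq ?filter_uniq ?iota_uniq // => k l.
  rewrite !mem_filter !mem_iota => /andP [_ /andP [k0 kf]] /andP [_ /andP [l0 lf]].
  (* Exponents from 1 to f are determined by their residues modulo f. *)
  move/eqP; rewrite (eq_prim_root_expr ef) => /eqP.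
  have [->|nk] := eqVneq k f; have [->|nl] := eqVneq l f => //.
  - by rewrite modnn modn_small => [E|]; lia.
  - by rewrite modnn modn_small => [E|]; lia.
  - by rewrite !modn_small //; lia.
have primJ : [set z : C | f.-primitive_root z] = [set` [seq eta R f ^+ k | k <- J]].
  apply/seteqP; split=> z /=.
    move=> zf; have [[i /= ltif] zE] := prim_rootP ef (prim_expr_order zf).
    have ci : coprime i f by move: zf; rewrite zE prim_root_exp_coprime.
    apply/mapP; case: i ltif zE ci => [|i] ltif zE ci.
      exists f; last by rewrite zE expr0 prim_expr_order.
      move: ci; rewrite /coprime gcd0n mem_filter mem_iota /coprime gcdnn => ->.
      by rewrite f0 add1n /=.
    by exists i.+1 => //; rewrite mem_filter ci mem_iota; lia.
  by move=> /mapP [k /JP kf ->]; apply: prim.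
pose term (k : nat) (s : K) : K := (eta R f ^+ k) ^ (- t) * cexp (- (t%:~R * s))
        / \prod_(b <- a) (1 - (eta R f ^+ k) ^+ b * cexp (b%:R * s)).
have -> : residue0 (fun s : C^o =>
      \sum_(z \in [set z : C | f.-primitive_root z])
        z ^ (- t) * cexp (- (t%:~R * s))
        / \prod_(b <- a) (1 - z ^+ b * cexp (b%:R * s))) =
    residue0 (fun s : K => \sum_(k <- J) term k s).
  congr (residue0 _); apply/funext => s; rewrite primJ -fsbig_seq // big_map.
  by [].
apply: residue0E.
pose P k : {poly C} :=
  ((eta R f ^+ k) ^ (- t) *: (exp_series R d \Po (- t%:~R *: 'X))) *
  (((-1) ^+ d / (\prod_(b <- a | (f %| b)%N) b%:R) *
    unit_factor f a (eta R f ^+ k)) *: A k).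
have Hh k : exists h : K -> K, coprime k f -> expands d h (P k) /\
    \forall s \near (0 : K), term k s = h s / s ^+ d.
  case: (boolP (coprime k f)) => [kf|_]; last by exists (cst 0).
  have [h hP hE] := expands_wave_term t (prim k kf) d0 a0 (HA k kf).
  by exists h.
have [h hP] := boolp.choice Hh.
have -> : \sum_(j <- J) \sum_(m < d) (-1) ^+ m / m`!%:R * t%:~R ^+ m *
      ((-1) ^+ d / (\prod_(b <- a | (f %| b)%N) b%:R) *
       unit_factor f a (eta R f ^+ j) * (A j)`_(d - m.+1) *
       (eta R f ^+ j) ^ (- t)) = (\sum_(j <- J) P j)`_d.-1.
  by rewrite coef_sum; apply: eq_bigr => j _; rewrite coef_wave_term.
apply: (@is_residue0_expands K d _ (fun s => \sum_(k <- J) h k s)) => //;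
  last first.
  by apply: expands_sum => k /JP kf; case: (hP k kf).
apply: nbhs_dnbhs; elim: {primJ uJ} J JP => [|k J IHJ] JP.
  by apply: filterE => s; rewrite !big_nil mul0r.
have [_ hk] := hP k (JP k (mem_head _ _)).
have IH := IHJ (fun l lJ => JP l ltac:(by rewrite inE lJ orbT)).
by apply: filterS2 hk IH => s hk IH; rewrite !big_cons mulrDl hk IH.
Qed.

End Residue.

(** * The quasi-polynomial and the cost bound *)

Lemma expz_prim_mod (F : fieldType) (f i : nat) (z : F) (t : int) :
  f.-primitive_root z -> (i <= f)%N -> (t = i %[mod f])%Z ->
  z ^ (- t) = z ^+ (f - i).
Proof.
move=> zf lif /eqP; rewrite eqz_mod_dvd => /dvdzP [q tq].
have z0 := prim_root_neq0 zf.
have -> : - t = f%:Z * (- q - 1) + (f - i)%N.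
  have -> : t = q * f + i by rewrite -tq subrK.
  by rewrite -subzn //; ring.
by rewrite expfzDr // -exprz_exp -exprnP (prim_expr_order zf) exp1rz mul1r.
Qed.

Lemma up_log_le_log_pos (R : realType) d : (0 < d)%N ->
  (up_log 2 d).+1%:R <= 3 / ln 2 * log_pos R d.
Proof.
move=> d0; have l2 : 0 < ln 2 :> R by rewrite ln_gt0 // ltr1n.
rewrite mulrAC ler_pdivlMr // /log_pos.
have [d1|d1] := leqP d 1.
  have -> : d = 1%N by lia.
  by rewrite up_log1 (_ : maxn 2 1 = 2) //; lra.
have /andP [jd _] := up_log_bounds (isT : (1 < 2)%N) d1.
rewrite (maxn_idPr d1).
have j0 : (0 < up_log 2 d)%N by rewrite up_log_gt0.
have lnd : (up_log 2 d).-1%:R * ln 2 <= ln d%:R :> R.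
  rewrite mulr_natl -lnXn // ler_ln ?posrE ?exprn_gt0 ?ltr0n //.
  by rewrite -natrX ler_nat ltnW.
have ln2d : ln 2 <= ln d%:R :> R by rewrite ler_ln ?posrE ?ltr0n // ler_nat.
have -> : (up_log 2 d).+1%:R = (up_log 2 d).-1%:R + 2 :> R.
  by rewrite -natrD addn2 prednK.
rewrite mulrDl; lra.
Qed.

Theorem theorem3p1 (R : realType) :
  exists C : R, forall (a : seq nat) (f : nat),
    all (fun b => 0 < b)%N a ->
    \big[gcdn/0%N]_(b <- a) b = 1%N ->
    (0 < f)%N ->
    has (fun b => f %| b)%N a ->
    let d := count (fun b => f %| b)%N a in
    let N := size a in
    exists (cost : nat) (P : seq (seq (complex R))),
      [/\ run (float_denum (complex R) f a) = Some (cost, P),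
          size P = f,
          forall (i : nat) (t : int),
            (1 <= i <= f)%N -> (t = i %[mod f])%Z ->
            sylvester_wave R f a t = (Poly (nth [::] P i.-1)).[t%:~R]
        & cost%:R <=
            C * ((f%:R * d%:R * log_pos R d + N%:R * log_pos R d ^+ 2)
                 * (totient f)%:R)].
Proof.
pose c : R := 3 / ln 2.
have l2 : 0 < ln 2 :> R by rewrite ln_gt0 // ltr1n.
have c0 : 0 < c by rewrite divr_gt0.
have logc := @up_log_le_log_pos R; rewrite -/c in logc; clearbody c.
exists (4560 * (2 * c + c ^+ 2)) => a f a0 _ f0 fa d N.
have d0 : (0 < d)%N by rewrite -has_count.
pose j := up_log 2 d; have dj : (0 < d <= 2 ^ j)%N by rewrite d0 up_logP.
have [A HA [cost [P [runE costE PE]]]] := ok_float_denum R f0 dj a0.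
exists cost, P; split=> //; first by rewrite -PE size_mkseq.
  move=> i t /andP [i1 lif] ti; rewrite (wave_residue t f0 d0 a0 HA) -PE.
  rewrite nth_mkseq; last by rewrite prednK.
  rewrite horner_mkseq exchange_big /= -sumrN; apply: eq_bigr => -[m /= ltm] _.
  rewrite /denum_coef -/d mulr_sumr mulr_suml -sumrN.
  rewrite big_seq [RHS]big_seq; apply: eq_bigr => k.
  rewrite mem_filter => /andP [kf _]; rewrite prednK //.
  rewrite (expz_prim_mod (f := f) (i := i)) ?prim_root_exp_coprime ?eta_prim //.
  by rewrite exprS exprD; ring.
pose bound := (4560 * ((f * mulcost j + size a * j.+1 ^ 2) * totient f))%N.
apply: (@le_trans _ _ bound%:R); first by rewrite ler_nat.
(* With j = up_log 2 d, j + 1 is at most c times log_pos d, and 2 ^ j is at most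
   2 d, because 2 ^ (j - 1) < d when d > 1. *)
have L0 : 0 < log_pos R d by rewrite ln_gt0 // ltr1n leq_max.
have jL : j.+1%:R <= c * log_pos R d := logc _ d0.
have dN : (2 ^ j)%:R <= 2 * d%:R :> R.
  rewrite -natrM ler_nat /j; have [d1|d1] := leqP d 1.
    by have -> : d = 1%N by lia.
  have /andP [jd _] := up_log_bounds (isT : (1 < 2)%N) d1.
  have : (0 < up_log 2 d)%N by rewrite up_log_gt0.
  by case: (up_log 2 d) jd => // k /=; rewrite expnS; lia.
rewrite /bound /mulcost !natrM natrD !natrM natrX -!mulrA ler_wpM2l ?ler0n //.
rewrite !mulrA ler_wpM2r ?ler0n // -/N.
rewrite natrX in dN; move: jL dN (ler0n R j.+1) (exprn_ge0 j (ler0n R 2)).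
move: (j.+1%:R) (2 ^+ j) => J M jL dN J0 M0.
have D0 := ler0n R d; have F0 := ler0n R f; have N0 := ler0n R N.
move: (log_pos R d) L0 jL (d%:R : R) D0 dN (f%:R : R) F0 (N%:R : R) N0.
move=> L L0 jL D D0 dN F F0 n n0.
have h1 : F * (J * M) <= F * (c * L * (2 * D)) by rewrite ler_wpM2l // ler_pM.
have h2 : n * (J * J) <= n * (c * L * (c * L)) by rewrite ler_wpM2l // ler_pM.
have X0 : 0 <= c ^+ 2 * (F * D * L) by rewrite !mulr_ge0 // ?sqr_ge0 // ltW.
have Y0 : 0 <= c * (n * L * L) by rewrite !mulr_ge0 // ltW.
apply: (@le_trans _ _ (F * (c * L * (2 * D)) + n * (c * L * (c * L)))).
  by apply: le_trans (lerD h1 h2); rewrite !mulrA.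
rewrite -subr_ge0 (_ : _ - _ = c ^+ 2 * (F * D * L) + 2 * (c * (n * L * L))).
  by rewrite addr_ge0 // mulr_ge0.
ring.
Qed.
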